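(* If $G$ is a finite simple perfect graph that does not contain a hole of length four, then $\mathrm{reg}(G)\leq 3$.
   Context: All graphs are finite and simple. A hole is an induced (chordless) cycle of length at least four. A graph is perfect if its chromatic number equals its clique number and the same holds for every induced subgraph. Fix a field $k$ of characteristic $0$. For a graph $G$ with vertex set $[n]$, the non-edge ideal is $I(G)=\langle x_ix_j : i\neq j,\ ij\notin E(G)\rangle\subseteq k[x_1,\dots,x_n]$, and $\mathrm{reg}(G):=\max\{r : \beta_{i,i+r}(I(G))\neq 0 \text{ for some } i\}$ is its Castelnuovo-Mumford regularity, where $\beta_{i,j}$ are the graded Betti numbers. If $G$ is complete (so $I(G)=0$), $\mathrm{reg}(G)=1$ by convention. *)

(* Defs.v *)
From Stdlib Require Import ClassicalEpsilon.
From HB Require Import structures.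
From mathcomp Require Import all_boot all_order all_algebra.
From mathcomp Require Import mpoly.

Set Implicit Arguments.
Unset Strict Implicit.
Unset Printing Implicit Defensive.

Import GRing.Theory.

Record graph (T : finType) := Graph {
  adj :> rel T;
  adj_sym : ssrbool.symmetric adj;
  adj_irr : irreflexive adj
}.

Section Graphs.
Variables (T : finType) (G : graph T).

Definition complete : bool := [forall x, forall y, (x != y) ==> G x y].

Definition clique (A : {set T}) : bool :=
  [forall x in A, forall y in A, (x != y) ==> G x y].

Definition clique_number : nat := \max_(A : {set T} | clique A) #|A|.

Definition colorable (c : nat) : bool :=
  [exists f : {ffun T -> 'I_c}, forall x, forall y, G x y ==> (f x != f y)].

Lemma colorable_card : exists c, colorable c.
Proof.
exists #|T|; apply/existsP; exists [ffun x => enum_rank x].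
apply/forallP=> x; apply/forallP=> y; apply/implyP=> Gxy; rewrite !ffunE.
by apply/negP=> /eqP/enum_rank_inj xy; move: Gxy; rewrite xy adj_irr.
Qed.

Definition chromatic_number : nat := ex_minn colorable_card.

Variable W : {set T}.

Definition induced_adj : rel {x : T | x \in W} := fun x y => G (val x) (val y).

Lemma induced_sym : ssrbool.symmetric induced_adj.
Proof. by move=> x y; apply: adj_sym. Qed.

Lemma induced_irr : irreflexive induced_adj.
Proof. by move=> x; apply: adj_irr. Qed.

Definition induced : graph {x : T | x \in W} := Graph induced_sym induced_irr.

End Graphs.

(* The case W = [set: T] is the graph G itself. *)
Definition perfect (T : finType) (G : graph T) : Prop :=
  forall W : {set T},
    chromatic_number (induced G W) = clique_number (induced G W).

(* c lists the vertices of the hole in cyclic order. *)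
Definition hole (T : finType) (G : graph T) (c : seq T) : bool :=
  [&& 4 <= size c, uniq c &
      [forall x in c, forall y in c,
         G x y == ((y == next c x) || (x == next c y))]].

Local Open Scope ring_scope.

Section Resolutions.
Variables (k : fieldType) (n : nat).
Local Notation S := {mpoly k[n]}.

(* The data of a complex ... -> F_1 -> F_0 -> S, where F_i is the direct sum of
   the S(-d), d ranging over [degs i]. Elements of F_i are row vectors, and maps
   act by right multiplication. Twists in nat suffice for ideals of S. *)
Record resolution := Resolution {
  degs : nat -> seq nat;
  aug : 'M[S]_(size (degs 0), 1);
  diff : forall i, 'M[S]_(size (degs i.+1), size (degs i))
}.

(* The degree-preserving maps from the sum of the S(-d), d in s, to the sum of
   the S(-d), d in t. *)
Definition graded_mx (s t : seq nat) (A : 'M[S]_(size s, size t)) : Prop :=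
  forall (a : 'I_(size s)) (b : 'I_(size t)),
    if (nth 0%N t b <= nth 0%N s a)%N
    then A a b \is (nth 0%N s a - nth 0%N t b)%N.-homog
    else A a b == 0.

Definition is_graded_resolution (I : S -> Prop) (F : resolution) : Prop :=
  [/\ graded_mx (t := [:: 0%N]) (aug F) /\
        (forall i, graded_mx (diff F i)),
      forall f : S, I f <-> exists v, f%:M = v *m aug F,
      forall v : 'rV_(size (degs F 0)),
        v *m aug F = 0 <-> exists w, v = w *m diff F 0
    & forall i (v : 'rV_(size (degs F i.+1))),
        v *m diff F i = 0 <-> exists w, v = w *m diff F i.+1].

(* Minimality: the image of F_(i+1) is contained in <x_1, ..., x_n> F_i. *)
Definition is_minimal (F : resolution) : Prop :=
  forall i a b, (diff F i a b)@_0%MM = 0.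

(* A minimal resolution is unique up to isomorphism, so the choice is immaterial
   for Betti numbers. *)
Definition minimal_resolution (I : S -> Prop) : resolution :=
  epsilon (inhabits (@Resolution (fun=> [::]) 0 (fun=> 0)))
    (fun F => is_graded_resolution I F /\ is_minimal F).

Definition betti (I : S -> Prop) (i j : nat) : nat :=
  count_mem j (degs (minimal_resolution I) i).

Definition nonedge_ideal (G : graph 'I_n) (f : S) : Prop :=
  exists c : 'I_n -> 'I_n -> S,
    f = \sum_(i < n) \sum_(j < n | (i != j) && ~~ G i j) c i j * ('X_i * 'X_j).

End Resolutions.

Definition is_max (P : nat -> Prop) (m : nat) : Prop :=
  P m /\ forall r, P r -> (r <= m)%N.

Definition reg (k : fieldType) (n : nat) (G : graph 'I_n) : nat :=
  if complete G then 1%N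
  else epsilon (inhabits 0%N)
         (is_max (fun r => exists i, betti (@nonedge_ideal k n G) i (i + r) <> 0%N)).

(* Main.v *)
(* By Hochster's formula the bound says that the clique complex of every induced
   subgraph has no homology in degree 2 or more.  Deleting a vertex v gives
   I(G) = I(G - v) + x_v (I(G[N(v)]) + (x_u : u not in N[v])), so reg G is at most
   the maximum of reg (G - v) and 1 + reg (G[N(v)]); it suffices to delete vertices
   with chordal neighbourhoods one by one, and chordal graphs are handled in the same
   way with simplicial vertices.

   Vertices with chordal neighbourhood exist (Parfenoff, Roussel, Rusu): choose a
   connected set C of maximal size with an anticomplete vertex v, and recurse on the
   vertices that are anticomplete to C; they are complete to the neighbours of C.
   This works provided that no hole H in N(v) has all its vertices attached to C.  If
   it had, consider a shortest path in C attached to two nonadjacent vertices of H of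
   opposite parity.  Holes through v and holes through arcs of H have even length,
   which forces the ends of the path to be attached to two disjoint edges of H and
   nothing else to be attached; then the same parities rule out connecting this path
   in C to a further vertex of H.

   Regularity is handled through [regular N], which asks for the first N steps of a
   not necessarily minimal graded resolution: this is stable under extensions and
   quotients, and by Schanuel's lemma it can be read off any cover, in particular
   from a minimal one. *)
From Stdlib Require Import Classical ClassicalEpsilon.
Require Import Defs.
From mathcomp Require Import all_boot all_order all_algebra zify.
From mathcomp Require Import mpoly.

Set Implicit Arguments.
Unset Strict Implicit.
Unset Printing Implicit Defensive.

Import GRing.Theory.

(** Perfection enters through odd holes: such a hole has clique number at most 2 but no proper
    2-colouring. All holes are then even of length at least 6, and bad configurations die because
    two holes force different parities on the same path.

    The obstacle is that a path of C reaching a further vertex of H is not a shortest one, so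
    nothing controls its attachments. Hence an invariant for all induced paths in C: the attached
    vertices of H either contain no nonadjacent pair of opposite parity, or form exactly two
    disjoint edges. Induction on the length works because in a shortest counterexample the offending
    attachment belongs to an end of the path.

    On the algebraic side [reg] refers to a chosen minimal resolution, so one has to be built first.
    Regularity with any bound supplies the finite generation of all syzygy modules used by the
    construction, and a comparison of covers bounds the degrees of whichever resolution is chosen.

    The constant 3 comes from two rounds of the deletion bound: cliques, with zero ideal, count as
    1, chordal graphs as 2. *)

Ltac nat_lia := repeat match goal with
  | H : context [adj] |- _ => clear H
  | H : context [@in_mem] |- _ => clear H
  | H : ~ is_true _ |- _ => clear H
  | H : is_true (?f _) |- _ => is_var f; clear H
  | H : forall _, _ |- _ => clear H
  end; lia.

(** * Holes and induced paths *)

Section Cycles.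
Variables (T : finType) (G : graph T).
Implicit Types (r q h : nat -> T).

(** Paths and cycles are functions on [nat] read only below their length, so that subpaths,
    reversals and gluings become index arithmetic. *)
Definition ipath r t :=
  (forall i j, i < t -> j < t -> r i = r j -> i = j) /\
  (forall i j, i < t -> j < t -> G (r i) (r j) = (i.+1 == j) || (j.+1 == i)).

Definition cadj N i j :=
  [|| i.+1 == j, j.+1 == i, (i == 0) && (j.+1 == N) | (j == 0) && (i.+1 == N)].

Definition cyc h N :=
  (forall i j, i < N -> j < N -> h i = h j -> i = j) /\
  (forall i j, i < N -> j < N -> G (h i) (h j) = cadj N i j).

Lemma ipath_sub r t p s : ipath r t -> p + s <= t -> ipath (fun i => r (p + i)) s.
Proof.
move=> [inj adj] le; split=> i j il jl; first by move/inj; lia.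
by rewrite adj; lia.
Qed.

Lemma ipath_rev r t : ipath r t -> ipath (fun i => r (t.-1 - i)) t.
Proof.
move=> [inj adj]; split=> i j il jl; first by move/inj; lia.
by rewrite adj; lia.
Qed.

Lemma ipath_cat q s r t : 0 < s -> ipath q s -> ipath r t ->
    (forall i j, i < s -> j < t -> q i <> r j) ->
    (forall i j, i < s -> j < t -> G (q i) (r j) = (i == s.-1) && (j == 0)) ->
  ipath (fun i => if i < s then q i else r (i - s)) (s + t).
Proof.
move=> s0 [qi qa] [ri ra] dis adj; split=> i j il jl.
  case: ltnP => is_; case: ltnP => js.
  - exact: qi.
  - by move=> E; case: (@dis i (j - s)) => //; lia.
  - by move=> /esym E; case: (@dis j (i - s)) => //; lia.
  - by move/ri; lia.
case: ltnP => is_; case: ltnP => js.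
- by rewrite qa //; lia.
- by rewrite adj //; lia.
- by rewrite adj_sym adj //; lia.
- by rewrite ra; lia.
Qed.

(** The second path is run backwards: index [s] is [r t.-1], and the last index is [r 0], next to
    [q 0]. *)
Lemma cyc_glue q s r t : 0 < s -> 0 < t -> 4 <= s + t -> ipath q s -> ipath r t ->
    (forall i j, i < s -> j < t -> q i <> r j) ->
    (forall i j, i < s -> j < t ->
       G (q i) (r j) = (i == 0) && (j == 0) || (i == s.-1) && (j == t.-1)) ->
  cyc (fun i => if i < s then q i else r ((s + t).-1 - i)) (s + t).
Proof.
move=> s0 t0 st [qi qa] [ri ra] dis adj; split=> i j il jl.
  case: ltnP => is_; case: ltnP => js.
  - exact: qi.
  - by move=> E; case: (dis _ _ _ _ E) => //; lia.
  - by move=> /esym E; case: (dis _ _ _ _ E) => //; lia.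
  - by move/ri; lia.
rewrite /cadj; case: ltnP => is_; case: ltnP => js.
- by rewrite qa //; lia.
- by rewrite adj //; lia.
- by rewrite adj_sym adj //; lia.
- by rewrite ra; lia.
Qed.

Lemma next_nth_cyc (c : seq T) x0 i : uniq c -> i < size c ->
  next c (nth x0 c i) = nth x0 c (if i.+1 == size c then 0 else i.+1).
Proof.
move=> uc ic; rewrite next_nth mem_nth //.
case: c uc ic => // y c uc ic; rewrite index_uniq //.
rewrite (_ : nth y c i = nth y (y :: c) i.+1) //.
case: eqP => [->|ne]; first by rewrite nth_default.
by apply: set_nth_default; move: ic ne => /=; lia.
Qed.

Lemma cadjE N i j : i < N -> j < N ->
  cadj N i j = (j == if i.+1 == N then 0 else i.+1) || (i == if j.+1 == N then 0 else j.+1).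
Proof. by rewrite /cadj => il jl; case: (i.+1 =P N) => ?; case: (j.+1 =P N) => ?; lia. Qed.

Lemma hole_cyc (c : seq T) x0 : hole G c -> cyc (nth x0 c) (size c).
Proof.
case/and3P => c4 uc /forall_inP adj; split=> i j il jl.
  by move/eqP; rewrite nth_uniq // => /eqP.
have /forall_inP/(_ (nth x0 c j)) := adj _ (mem_nth x0 il).
rewrite mem_nth // => /(_ isT)/eqP ->.
have lt l : l < size c -> (if l.+1 == size c then 0 else l.+1) < size c.
  by move=> lc; case: eqP => [_|/eqP ne]; [apply: leq_trans c4 | rewrite ltn_neqAle ne].
by rewrite cadjE // !next_nth_cyc // !nth_uniq // lt.
Qed.

Lemma cyc_hole h N : 4 <= N -> cyc h N ->
  exists c, [/\ hole G c, size c = N & forall x, x \in c -> exists2 i, i < N & x = h i].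
Proof.
move=> N4 [inj adj]; have sz : size (mkseq h N) = N by rewrite size_mkseq.
have mem x : x \in mkseq h N -> exists2 i, i < N & x = h i.
  by case/mapP => i; rewrite mem_iota => /andP[_ iN] ->; exists i.
have uc : uniq (mkseq h N).
  rewrite map_inj_in_uniq ?iota_uniq // => i j; rewrite !mem_iota => /andP[_ iN] /andP[_ jN].
  exact: inj.
exists (mkseq h N); split=> //; apply/and3P; split=> //; first by rewrite sz.
apply/forall_inP => x /mem[i iN ->]; apply/forall_inP => y /mem[j jN ->].
have E l : l < N -> next (mkseq h N) (h l) = h (if l.+1 == N then 0 else l.+1).
  move=> lN; rewrite -{1}(nth_mkseq (h 0) h lN) next_nth_cyc ?sz // nth_mkseq //.
  by case: eqP; lia.
have heq l l' : l < N -> l' < N -> (h l == h l') = (l == l').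
  by move=> lN lN'; apply/eqP/eqP => [|-> //]; apply: inj.
rewrite !E // !heq ?adj ?cadjE //.
  by case: eqP => ?; lia.
by case: eqP => ?; lia.
Qed.

End Cycles.

(** * Parities of two alternating sets of positions *)

Lemma last_before (X : pred nat) q :
  (forall l, l < q -> ~~ X l) \/ exists2 y, y < q & X y /\ forall l, y < l < q -> ~~ X l.
Proof.
elim: q => [|q [IH|[y yq [Xy IH]]]]; first by left.
  have [Xq|nXq] := boolP (X q); last first.
    by left=> l; rewrite ltnS leq_eqVlt => /orP[/eqP ->|/IH].
  by right; exists q => //; split=> // l; lia.
have [Xq|nXq] := boolP (X q); first by right; exists q => //; split=> // l; lia.
right; exists y; [lia | split=> // l /andP[yl]].
by rewrite ltnS leq_eqVlt => /orP[/eqP ->//|lq]; apply: IH; rewrite yl.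
Qed.

Lemma first_after (X : pred nat) y p : y < p -> X p ->
  exists2 x, y < x <= p & X x /\ forall l, y < l < x -> ~~ X l.
Proof.
move=> yp Xp; have ex : exists x, (y < x) && X x by exists p; rewrite yp.
case: (ex_minnP ex) => x /andP[yx Xx] xmin; exists x.
  by rewrite yx xmin // yp.
split=> // l /andP[yl lx]; apply/negP => Xl.
by have := xmin l; rewrite yl Xl leqNgt lx => /(_ isT).
Qed.

Lemma last_exists (X : pred nat) m : (exists p, X p) -> (forall p, X p -> p < m) ->
  exists2 p, X p & forall q, p < q -> ~~ X q.
Proof.
move=> ex bd; have bd' p : X p -> p <= m by move/bd/ltnW.
case: (ex_maxnP ex bd') => p Xp pmax.
by exists p => // q pq; apply/negP => /pmax; rewrite leqNgt pq.
Qed.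

Lemma nat_min (P : nat -> Prop) : (exists x, P x) -> exists2 x, P x & forall y, P y -> x <= y.
Proof.
move=> [x Px]; apply: NNPP => none.
suff H y : forall z, z < y -> ~ P z by exact: (H x.+1 x).
elim: y => // y IH z; rewrite ltnS leq_eqVlt => /orP[/eqP ->|/IH //] Py.
apply: none; exists y => // w Pw; rewrite leqNgt; apply/negP => wy.
exact: IH Pw.
Qed.

(** Abstracts the positions on a path attached to [h 1] and to [h N.-1], the two rim neighbours of
    [h 0]. The parities are those forced by holes; in the exceptional cases [p = 0] and [q = p.+1]
    the cycle in question is a triangle. *)
Definition alternation (X Y : pred nat) :=
  [/\ forall p, X p -> ~~ Y p,
      forall p, X p -> (forall q, q < p -> ~~ X q) -> p = 0 \/ odd p,
      forall p q, p < q -> X p -> X q -> (forall l, p < l < q -> ~~ X l) ->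
        q = p.+1 \/ ~~ odd (q - p)
    & forall p q, p < q -> X p -> Y q -> (forall l, p < l < q -> ~~ X l && ~~ Y l) ->
        ~~ odd (q - p)].

(** If [q] is the first element of [Y], it is odd because it is positive. Otherwise the preceding
    element [y] of [Y] lies before [p], the next element of either set after [y] is in [X], and
    induction with the roles exchanged makes [y] odd, while [q - y] is even. In both cases [q] is
    odd and [q - p] is even. *)
Lemma switch_odd X Y p q : alternation X Y -> alternation Y X -> p < q -> X p -> Y q ->
  (forall l, p < l < q -> ~~ X l && ~~ Y l) -> odd p.
Proof.
elim/ltn_ind: p X Y q => p IH X Y q aXY aYX pq Xp Yq pq0.
have [dXY _ _ cXY] := aXY; have [dYX fY sY _] := aYX.
have pqE := cXY _ _ pq Xp Yq pq0.
have [none|[y yq [Yy yl]]] := last_before Y q.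
  by have [|] := fY _ Yq none; lia.
have yp : y < p.
  rewrite ltn_neqAle; apply/andP; split; first by apply: contraL Yy => /eqP ->; apply: dXY.
  by rewrite leqNgt; apply/negP => py; have := pq0 y; rewrite py yq Yy andbF => /(_ isT).
have [x /andP[yx xp] [XYx xl]] := @first_after (fun l => X l || Y l) y p yp (introT orP (or_introl Xp)).
have Xx : X x.
  by case/orP: XYx => // Yx; have := yl x; rewrite yx (leq_ltn_trans xp pq) Yx => /(_ isT).
have yo : odd y.
  apply: (IH y yp Y X x) => // l /xl; by rewrite negb_or andbC.
by have [|] := sY _ _ yq Yy Yq yl; lia.
Qed.

(** Of the last elements of [X] and [Y], the smaller one is followed by the other set, so it is odd
    by [switch_odd] and even by hypothesis. *)
Lemma alternation_absurd X Y m : alternation X Y -> alternation Y X ->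
    (forall p, X p -> (forall q, p < q -> ~~ X q) -> ~~ odd p) ->
    (forall p, Y p -> (forall q, p < q -> ~~ Y q) -> ~~ odd p) ->
    (forall p, X p || Y p -> p < m) -> (exists p, X p) -> (exists p, Y p) -> False.
Proof.
have wlog_lt X' Y' a b : alternation X' Y' -> alternation Y' X' ->
    (forall p, Y' p -> (forall q, p < q -> ~~ Y' q) -> ~~ odd p) ->
    X' a -> Y' b -> (forall q, b < q -> ~~ Y' q) -> b < a -> False.
  move=> aXY aYX lY Xa Yb bmax ba.
  have [x /andP[bx xa] [Xx xl]] := first_after ba Xa.
  have := lY b Yb bmax; rewrite (switch_odd aYX aXY bx Yb Xx) // => l lx.
  by rewrite xl // andbT; apply: bmax; case/andP: lx.
move=> aXY aYX lX lY bd exX exY.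
have [a Xa amax] := last_exists exX (fun p Xp => bd p (introT orP (or_introl Xp))).
have [b Yb bmax] := last_exists exY (fun p Yp => bd p (introT orP (or_intror Yp))).
have [ab|ba|ab] := ltngtP a b.
- exact: wlog_lt aYX aXY lX Yb Xa amax ab.
- exact: wlog_lt aXY aYX lY Xa Yb bmax ba.
- by have [/(_ a Xa)] := aXY; rewrite ab Yb.
Qed.

(** * Shortest paths inside a connected set *)

Section ShortestPaths.
Variables (T : finType) (G : graph T) (C : {set T}).
Implicit Types (r : nat -> T) (D : pred T).

Definition within : rel T := [rel x y | [&& G x y, x \in C & y \in C]].

Definition connected_set := forall x y, x \in C -> y \in C -> connect within x y.

Definition walk D1 D2 t := exists r, [/\ 0 < t, forall p, p < t -> r p \in C,
  forall p, p.+1 < t -> G (r p) (r p.+1), D1 (r 0) & D2 (r t.-1)].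

Lemma connect_walk x y : connect within x y -> x \in C ->
  exists r t, [/\ 0 < t, forall p, p < t -> r p \in C,
    forall p, p.+1 < t -> G (r p) (r p.+1), r 0 = x & r t.-1 = y].
Proof.
case/connectP => s ps -> xC; exists (nth x (x :: s)), (size s).+1.
have ws p : p < size s -> within (nth x (x :: s) p) (nth x (x :: s) p.+1).
  by move=> lt; move/(pathP x)/(_ p lt): ps.
split=> //; last by rewrite [LHS](nth_last x (x :: s)).
  by case=> [|p] //; rewrite ltnS => /ws /and3P[].
by move=> p; rewrite ltnS => /ws /and3P[].
Qed.

(** A walk of minimal length works: a chord, a repetition, or an end condition met at the wrong
    place would shorten it. *)
Lemma shortest_path D1 D2 x y : connected_set -> x \in C -> D1 x -> y \in C -> D2 y ->
  exists r t, [/\ 0 < t, ipath G r t /\ forall p, p < t -> r p \in C, D1 (r 0) /\ D2 (r t.-1),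
    forall p, 0 < p < t -> ~~ D1 (r p) & forall p, p < t.-1 -> ~~ D2 (r p)].
Proof.
move=> con xC Dx yC Dy.
have [r0 [t0 [t00 r0C r0G r00 r0t]]] := connect_walk (con x y xC yC) xC.
have [t [r [tpos rC rG D1r D2r]] tmin] := nat_min (ex_intro (walk D1 D2) t0
  (ex_intro _ r0 (And5 t00 r0C r0G (etrans (congr1 D1 r00) Dx) (etrans (congr1 D2 r0t) Dy)))).
have n1 p : 0 < p < t -> ~~ D1 (r p).
  move=> pt; apply/negP => Dp; have := tmin (t - p); suff : walk D1 D2 (t - p) by move=> w /(_ w); lia.
  exists (fun q => r (p + q)); split; rewrite ?addn0 //; first by lia.
  - by move=> q qt; apply: rC; lia.
  - by move=> q qt; rewrite addnS; apply: rG; lia.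
  - by rewrite (_ : p + (t - p).-1 = t.-1) //; lia.
have n2 p : p < t.-1 -> ~~ D2 (r p).
  move=> pt; apply/negP => Dp; have := tmin p.+1; suff : walk D1 D2 p.+1 by move=> w /(_ w); lia.
  by exists r; split=> // q qt; [apply: rC; lia | apply: rG; lia].
have nchord i j : i.+1 < j < t -> ~~ G (r i) (r j).
  move=> ijt; apply/negP => Gij; have := tmin (t - (j - i.+1)).
  suff : walk D1 D2 (t - (j - i.+1)) by move=> w /(_ w); lia.
  exists (fun q => if q <= i then r q else r (q + (j - i.+1))); split.
  - by lia.
  - by move=> q qt; case: ifP => qi; apply: rC; lia.
  - move=> q qt; have [qi|[qi|qi]] : q < i \/ q = i \/ i < q by lia.
    + by rewrite (ltnW qi) qi; apply: rG; lia.
    + by rewrite qi leqnn ltnn (_ : i.+1 + (j - i.+1) = j) //; lia.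
    + by rewrite leqNgt qi ltnNge (ltnW qi) addSn; apply: rG; lia.
  - by rewrite leq0n.
  - by rewrite ifF; [rewrite (_ : (t - (j - i.+1)).-1 + (j - i.+1) = t.-1) //; lia | lia].
(* A repetition makes [r i] adjacent to [r j.+1], a chord already excluded; if [j] is the last
   index, [D2] holds too early at [i]. *)
have inj i j : i < j -> j < t -> r i <> r j.
  move=> ij jt E; have [jl|jl] := eqVneq j.+1 t.
    by have := n2 i; rewrite E (_ : j = t.-1) ?D2r; lia.
  have lt : i.+1 < j.+1 < t by lia.
  by have := nchord _ _ lt; rewrite E rG //; lia.
exists r, t; split=> //; split=> //; split=> i j it jt.
  by have [ij|ji|//] := ltngtP i j; [move/(inj _ _ ij jt) | move/esym/(inj _ _ ji it)].
have ge i' j' : i' < j' -> j' < t -> G (r i') (r j') = (i'.+1 == j').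
  move=> ij jt'; have [<-|ne] := eqVneq i'.+1 j'; first by apply: rG; lia.
  by apply/negbTE/nchord; lia.
have [ij|ji|->] := ltngtP i j; last by rewrite adj_irr; lia.
- by rewrite ge //; lia.
- by rewrite adj_sym ge //; lia.
Qed.

End ShortestPaths.

(** * A hole in the neighbourhood of v, and paths that avoid v and its neighbours *)

Section Attachments.
Variables (T : finType) (G : graph T).
Hypothesis even_cyc : forall h N, 4 <= N -> cyc G h N -> N <> 4 /\ ~~ odd N.
Variables (v : T) (C : {set T}) (N : nat).
Hypothesis Cv : forall c, c \in C -> c != v /\ ~~ G v c.
Hypothesis N6 : 6 <= N.
Hypothesis evenN : ~~ odd N.
Implicit Types r h : nat -> T.

(** Otherwise [x], [u], [y], [w] is a hole of length four. *)
Lemma square_chord x y u w : x != y -> ~~ G x y -> u != w ->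
  G u x -> G u y -> G w x -> G w y -> G u w.
Proof.
move=> xy nxy uw ux uy wx wy; apply/negPn/negP => nuw.
pose s := [:: x; u; y; w].
have E i j : i < 4 -> j < 4 -> nth x s i = nth x s j -> i = j.
  move: ux uy wx wy uw xy; case: i => [|[|[|[|i]]]] //; case: j => [|[|[|[|j]]]] //= ux uy wx wy uw xy _ _ e;
  by move: ux uy wx wy uw xy; rewrite ?e ?adj_irr ?eqxx.
have : cyc G (nth x s) 4.
  split=> // i j; case: i => [|[|[|[|i]]]] //; case: j => [|[|[|[|j]]]] //= _ _;
  rewrite /cadj /= ?adj_irr ?ux ?uy ?wx ?wy ?(negbTE nxy) ?(negbTE nuw) //;
  by rewrite adj_sym ?ux ?uy ?wx ?wy ?(negbTE nxy) ?(negbTE nuw).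
by case/(even_cyc (leqnn 4)).
Qed.

Definition rim h := cyc G h N /\ forall i, i < N -> G v (h i).

(** Addition of [a] modulo [N]. Together with negation [flip] it generates the symmetries that bring
    configurations into normal form. *)
Definition rot a i := if a + i < N then a + i else a + i - N.
Definition flip i := if i is 0 then 0 else N - i.

Lemma rim_comp h s : rim h -> (forall i, i < N -> s i < N) ->
    (forall i j, i < N -> j < N -> cadj N (s i) (s j) = cadj N i j) ->
    (forall i j, i < N -> j < N -> s i = s j -> i = j) ->
  rim (h \o s).
Proof.
move=> [[hi ha] hv] sN sa si; split=> [|i iN]; last by apply: hv; apply: sN.
split=> i j iN jN /=; last by rewrite ha ?sN // sa.
by move/hi => /(_ (sN _ iN) (sN _ jN)); apply: si.
Qed.

Definition nx i := if i.+1 == N then 0 else i.+1.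

Lemma nx_lt i : i < N -> nx i < N.
Proof. by rewrite /nx => iN; case: eqP => ?; lia. Qed.

Lemma nx_inj i j : i < N -> j < N -> (nx i == nx j) = (i == j).
Proof.
by rewrite /nx => iN jN; case: (i.+1 =P N) => iE; case: (j.+1 =P N) => jE; lia.
Qed.

Lemma odd_nx i : i < N -> odd (nx i) = ~~ odd i.
Proof. by rewrite /nx => iN; case: eqP => ?; lia. Qed.

Lemma nx_nx i : nx (nx i) != i.
Proof. by rewrite /nx; case: (i.+1 =P N) => iE; [case: (1 =P N)|case: (i.+2 =P N)] => ?; lia. Qed.

Lemma cadj_nx i j : i < N -> j < N -> cadj N i j = (j == nx i) || (i == nx j).
Proof. exact: cadjE. Qed.

Lemma rot_lt a i : a < N -> i < N -> rot a i < N.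
Proof. by rewrite /rot => aN iN; case: (ltnP (a + i) N) => ?; lia. Qed.

Lemma rot_inj a i j : a < N -> i < N -> j < N -> (rot a i == rot a j) = (i == j).
Proof.
rewrite /rot => aN iN jN.
by case: (ltnP (a + i) N) => ?; case: (ltnP (a + j) N) => ?; lia.
Qed.

Lemma rot_nx a i : a < N -> i < N -> rot a (nx i) = nx (rot a i).
Proof.
rewrite /rot /nx => aN iN; case: (i.+1 =P N) => iE.
  by rewrite addn0 aN; case: (ltnP (a + i) N) => ?; case: eqP => ?; lia.
by case: (ltnP (a + i) N) => ?; case: (ltnP (a + i.+1) N) => ?; case: eqP => ?; lia.
Qed.

Lemma odd_rot a i : odd (rot a i) = odd (a + i).
Proof. by rewrite /rot; case: ltnP => ?; lia. Qed.

Lemma cadj_rot a i j : a < N -> i < N -> j < N -> cadj N (rot a i) (rot a j) = cadj N i j.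
Proof. by move=> aN iN jN; rewrite !cadj_nx ?rot_lt // -!rot_nx // !rot_inj ?nx_lt. Qed.

Lemma flip_lt i : i < N -> flip i < N.
Proof. by case: i => [|i]; rewrite /flip; lia. Qed.

Lemma flip_inj i j : i < N -> j < N -> (flip i == flip j) = (i == j).
Proof. by rewrite /flip; case: i => [|i]; case: j => [|j] iN jN; lia. Qed.

Lemma nx_flip i : i < N -> nx (flip (nx i)) = flip i.
Proof.
move=> iN; rewrite /nx; case: (i.+1 =P N) => iE.
  by rewrite /flip; case: (1 =P N) => ?; case: i iN iE => [|i]; lia.
rewrite /flip; case: ((N - i.+1).+1 =P N) => iF; case: i iN iE iF => [|i]; lia.
Qed.

Lemma odd_flip i : i < N -> odd (flip i) = odd i.
Proof. by rewrite /flip; case: i => [|i]; lia. Qed.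

Lemma cadj_flip i j : i < N -> j < N -> cadj N (flip i) (flip j) = cadj N i j.
Proof.
have E x y : x < N -> y < N -> (flip y == nx (flip x)) = (x == nx y).
  by move=> xN yN; rewrite -(nx_flip yN) nx_inj ?flip_lt ?nx_lt // flip_inj ?nx_lt // eq_sym.
by move=> iN jN; rewrite !cadj_nx ?flip_lt // !E // orbC.
Qed.

Lemma rim_rot a h : a < N -> rim h -> rim (h \o rot a).
Proof.
move=> aN hh; apply: rim_comp => // [i iN|i j iN jN|i j iN jN /eqP]; first exact: rot_lt.
  exact: cadj_rot.
by rewrite rot_inj // => /eqP.
Qed.

Lemma rim_flip h : rim h -> rim (h \o flip).
Proof.
move=> hh; apply: rim_comp => // [i iN|i j iN jN|i j iN jN /eqP]; first exact: flip_lt.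
  exact: cadj_flip.
by rewrite flip_inj // => /eqP.
Qed.

Lemma rim_disjoint h i c : rim h -> i < N -> c \in C -> h i <> c.
Proof. by move=> [_ hv] iN /Cv[_ /negP nvc] hc; apply: nvc; rewrite -hc; apply: hv. Qed.

(** [v] and [c] are nonadjacent, so two nonadjacent rim vertices attached to [c] would form a hole
    of length four with them. *)
Lemma attached_clique h c i j : rim h -> c \in C -> i < N -> j < N ->
  G c (h i) -> G c (h j) -> i = j \/ cadj N i j.
Proof.
move=> [[hi ha] hv] cC iN jN ci cj; have [->|ij] := eqVneq i j; first by left.
right; rewrite -ha //; apply/negPn/negP => nij.
have [cv nvc] := Cv cC; have := nvc; rewrite (@square_chord (h i) (h j) v c) ?hv //.
  by apply: contraNneq ij => /hi ->.
by rewrite eq_sym.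
Qed.

Definition cpath r t := ipath G r t /\ forall p, p < t -> r p \in C.

Lemma cpath_sub r t p s : cpath r t -> p + s <= t -> cpath (fun i => r (p + i)) s.
Proof. by move=> [ir rC] le; split=> [|i il]; [apply: ipath_sub ir le | apply: rC; lia]. Qed.

Lemma cpath_rev r t : cpath r t -> cpath (fun i => r (t.-1 - i)) t.
Proof. by move=> [ir rC]; split=> [|i il]; [apply: ipath_rev ir | apply: rC; lia]. Qed.

Lemma rim_arc h i s : rim h -> i + s <= N -> s < N -> ipath G (fun l => h (i + l)) s.
Proof.
move=> [[hi ha] _] le sN; split=> l l' ll ll'; first by move/hi; lia.
by rewrite ha /cadj; lia.
Qed.

(* A path in C whose two ends are joined by an arc of the rim closes up to a hole. *)
Lemma even_arc h r t i s : rim h -> cpath r t -> 0 < s -> i + s <= N -> s < N ->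
    0 < t -> 4 <= s + t ->
    (forall l p, l < s -> p < t ->
      G (r p) (h (i + l)) = (l == 0) && (p == 0) || (l == s.-1) && (p == t.-1)) ->
  ~~ odd (s + t).
Proof.
move=> hh [ir rC] s0 le sN t0 st adj; apply: (even_cyc st _).2.
apply: cyc_glue (rim_arc hh le sN) ir _ _ => // l p ls pt; last by rewrite adj_sym adj.
by apply: rim_disjoint hh _ (rC _ pt); lia.
Qed.

(* The path closes up to a hole through v. *)
Lemma odd_apex h r t i j : rim h -> cpath r t -> 0 < t -> i < N -> j < N ->
    i != j -> ~~ cadj N i j ->
    (forall p, p < t -> G (r p) (h i) = (p == 0)) ->
    (forall p, p < t -> G (r p) (h j) = (p == t.-1)) ->
  odd t.
Proof.
move=> hh [ir rC] t0 iN jN ij nij ai aj; have [[hi ha] hv] := hh.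
suff : ~~ odd (3 + t) by rewrite oddD /= negbK.
pose q := nth v [:: h i; v; h j].
have hij : h i <> h j by move/hi => /(_ iN jN) /eqP; apply/negP.
have hnv l : l < N -> h l <> v by move=> lN E; have := hv _ lN; rewrite E adj_irr.
have st : 4 <= 3 + t by lia.
have nji : cadj N j i = false by move: nij; rewrite /cadj; lia.
have iq : ipath G q 3.
  split=> a b; case: a => [|[|[|a]]] //; case: b => [|[|[|b]]] // _ _; rewrite /q /=;
    rewrite ?adj_irr ?hv ?[G _ v]adj_sym ?hv ?ha ?(negbTE nij) ?nji // => E;
    first [case: (hij E) | case: (hij (esym E)) | case: (hnv _ iN E) | case: (hnv _ jN E)
      | case: (hnv _ iN (esym E)) | case: (hnv _ jN (esym E))].
apply: (even_cyc st _).2; apply: cyc_glue iq ir _ _ => //.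
- move=> a p; case: a => [|[|[|a]]] //= _ pt; rewrite /q /=.
  + exact: rim_disjoint hh iN (rC _ pt).
  + by move=> E; have [/eqP] := Cv (rC _ pt); rewrite E.
  + exact: rim_disjoint hh jN (rC _ pt).
- move=> a p; case: a => [|[|[|a]]] //= _ pt; rewrite /q /=.
  + by rewrite adj_sym ai // orbF.
  + by have [_ /negbTE ->] := Cv (rC _ pt).
  + by rewrite adj_sym aj //; lia.
Qed.


(** * Paths attached to nonadjacent rim vertices of opposite parity *)

Definition opair i j := odd (i + j) && ~~ cadj N i j.

Lemma opair_rot a i j : a < N -> i < N -> j < N -> opair (rot a i) (rot a j) = opair i j.
Proof.
move=> aN iN jN; rewrite /opair cadj_rot // !oddD !odd_rot !oddD.
by case: (odd a); case: (odd i); case: (odd j).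
Qed.

Lemma opair_flip i j : i < N -> j < N -> opair (flip i) (flip j) = opair i j.
Proof. by move=> iN jN; rewrite /opair cadj_flip // !oddD !odd_flip. Qed.

(* l is an end of the rim edge i(i+1), indices modulo N. *)
Definition sedge i l := [|| l == i, l == i.+1 | (l == 0) && (i.+1 == N)].

Lemma sedge_nx i l : i < N -> l < N -> sedge i l = (l == i) || (l == nx i).
Proof. by rewrite /sedge /nx => iN lN; case: (i.+1 =P N) => ?; lia. Qed.

Lemma sedge_rot a i l : a < N -> i < N -> l < N -> sedge (rot a i) (rot a l) = sedge i l.
Proof. by move=> aN iN lN; rewrite !sedge_nx ?rot_lt // -rot_nx // !rot_inj ?nx_lt. Qed.

Lemma sedge_flip i l : i < N -> l < N -> sedge (flip (nx i)) (flip l) = sedge i l.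
Proof.
move=> iN lN; rewrite !sedge_nx ?flip_lt ?nx_lt // nx_flip // !flip_inj ?nx_lt //.
by rewrite orbC.
Qed.

(** Satisfied by a subpath whose ends realise an opposite pair at the smallest possible distance
    along the path. *)
Definition tight h r m := forall p q i j, p < m -> q < m -> i < N -> j < N -> opair i j ->
  G (r p) (h i) -> G (r q) (h j) -> p = 0 /\ q = m.-1 \/ p = m.-1 /\ q = 0.

Definition two_edges h r m i j := forall p l, p < m -> l < N ->
  G (r p) (h l) = (p == 0) && sedge i l || (p == m.-1) && sedge j l.

(** Normal form after rotating the first attachment to [h 0]. For odd [j], the bounds say that 0 and
    [j] are nonadjacent; [m] exceeds 1 because by [attached_clique] one vertex cannot be attached to
    both. *)
Record tight_path h r m j : Prop := TightPath {
  tp_rim : rim h;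
  tp_path : cpath r m;
  tp_tight : tight h r m;
  tp_first : G (r 0) (h 0);
  tp_end : G (r m.-1) (h j);
  tp_range : [&& odd j, 2 < j, j + 2 < N & 1 < m]
}.

Ltac rim_lia := repeat match goal with
  | H : context [adj] |- _ => clear H
  | H : tight_path _ _ _ _ |- _ => clear H
  | H : cpath _ _ |- _ => clear H
  | H : tight _ _ _ |- _ => clear H
  | H : rim _ |- _ => clear H
  | H : context [opair] |- _ => clear H
  | H : context [sedge] |- _ => clear H
  | H : context [@in_mem] |- _ => clear H
  | H : ~ is_true _ |- _ => clear H
  | H : is_true (?f _) |- _ => is_var f; clear H
  | H : forall _, _ |- _ => clear H
  end; lia.

Lemma tp_flip h r m j : tight_path h r m j -> tight_path (h \o flip) r m (N - j).
Proof.
move=> [hh rr tt h0 hj range]; split=> //; first exact: rim_flip.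
- by move=> p q i l pm qm iN lN oil; apply: tt; rewrite ?flip_lt ?opair_flip.
- by rewrite /= (_ : flip (N - j) = j) // /flip; case E: (N - j) => [|d]; rim_lia.
- rim_lia.
Qed.

Lemma tp_rev h r m j : tight_path h r m j ->
  tight_path (h \o rot j) (fun p => r (m.-1 - p)) m (N - j).
Proof.
move=> [hh rr tt h0 hj range]; split=> /=; first by apply: rim_rot hh; rim_lia.
- exact: cpath_rev.
- move=> p q i l pm qm iN lN oil pi ql; have jN : j < N by rim_lia.
  have o : opair (rot j i) (rot j l) by rewrite opair_rot.
  have [pm' qm'] : m.-1 - p < m /\ m.-1 - q < m by split; rim_lia.
  by have := tt _ _ _ _ pm' qm' (rot_lt jN iN) (rot_lt jN lN) o pi ql; rim_lia.
- by rewrite /rot subn0 addn0 ifT //; rim_lia.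
- by rewrite /rot subnn subnKC ?ltnn ?subnn //; rim_lia.
- rim_lia.
Qed.

Lemma tp_zero h r m j p : tight_path h r m j -> p < m -> G (r p) (h 0) -> p = 0.
Proof.
move=> [hh rr tt h0 hj range] pm p0.
by have := tt p m.-1 0 j; rewrite /opair /cadj; case=> //; rim_lia.
Qed.

Lemma tp_last h r m j p : tight_path h r m j -> p < m -> G (r p) (h j) -> p = m.-1.
Proof.
move=> [hh rr tt h0 hj range] pm p0.
by have := tt 0 p 0 j; rewrite /opair /cadj; case=> //; rim_lia.
Qed.

(** An odd index not adjacent to 0 is opposite to 0, so by tightness it is attached to the last
    vertex, which is also attached to [j]; [attached_clique] then brings the index next to [j]. Even
    indices and the first vertex behave in the same way. *)
Lemma tp_six h r m j p i : tight_path h r m j -> p < m -> i < N -> G (r p) (h i) ->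
  [|| i == 0, i == 1, i.+1 == N, i == j, i.+1 == j | i == j.+1].
Proof.
move=> tp pm iN pi; have [hh [_ rC] tt h0 hj range] := tp.
have pC := rC _ pm; apply/negPn/negP => far.
have [oi|ei] := boolP (odd i).
  have pE : p = m.-1.
    by have := tt 0 p 0 i; rewrite /opair /cadj; case=> //; rim_lia.
  rewrite pE in pC pi; have := attached_clique hh pC iN _ pi hj.
  by rewrite /cadj; case=> //; rim_lia.
have pE : p = 0.
  by have := tt p m.-1 i j; rewrite /opair /cadj; case=> //; rim_lia.
rewrite pE in pC pi; have := attached_clique hh pC iN _ pi h0.
by rewrite /cadj; case=> //; rim_lia.
Qed.

Lemma tp_odd h r m j : tight_path h r m j -> odd m.
Proof.
move=> tp; have [hh rr tt h0 hj range] := tp.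
apply: (odd_apex (i := 0) (j := j) hh rr); rewrite /cadj; try rim_lia.
- by move=> p pm; apply/idP/eqP => [/(tp_zero tp pm)|->].
- by move=> p pm; apply/idP/eqP => [/(tp_last tp pm)|->].
Qed.

(** Otherwise the arc from 0 to [j] and the path form a hole of length [j.+1 + m], which is odd. *)
Lemma tp_side h r m j : tight_path h r m j ->
  exists2 p, p < m & G (r p) (h 1) || G (r p) (h j.-1).
Proof.
move=> tp; have [hh rr tt h0 hj range] := tp; have om := tp_odd tp.
apply: NNPP => none.
have no p l : p < m -> l < N -> 0 < l < j -> G (r p) (h l) = false.
  move=> pm lN lj; apply/negP => pl; apply: none; exists p => //.
  have := tp_six tp pm lN pl => six.
  have [|] : l = 1 \/ l = j.-1 by rim_lia.
    by move=> <-; rewrite pl.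
  by move=> <-; rewrite pl orbT.
suff : ~~ odd (j.+1 + m) by rim_lia.
apply: (even_arc (i := 0) hh rr); try rim_lia.
move=> l p lj pm; rewrite add0n.
have [->|l0] := eqVneq l 0.
  apply/idP/idP => [/(tp_zero tp pm) ->|]; first by rewrite eqxx.
  by rewrite /= (_ : (0 == j) = false) ?orbF => [/eqP ->|]; last rim_lia.
have [->|lj'] := eqVneq l j.
  apply/idP/idP => [/(tp_last tp pm) ->|]; first by rewrite eqxx.
  by move/eqP ->.
by rewrite no //; rim_lia.
Qed.

Lemma tp_side' h r m j : tight_path h r m j ->
  exists2 p, p < m & G (r p) (h N.-1) || G (r p) (h j.+1).
Proof.
move=> tp; have rg := tp_range tp.
have [p pm] := tp_side (tp_flip tp); rewrite /= subn1.
rewrite (_ : flip (N - j).-1 = j.+1) ; last by rewrite /flip; case E: (N - j).-1 => [|d]; rim_lia.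
by exists p.
Qed.

(** By tightness [h 1] is attached to the first vertex only and [h j.+1] to the last only. For
    [j > 3] the indices 1 and [j.-1] are opposite, so the last vertex would be attached to both
    [j.-1] and [j.+1]. For [j = 3] the first contact [f] with [h 2] gets contradictory parities from
    the hole through [h 0], [v], [h 2] and the hole through the edge 12. *)
Lemma tp_diagonal h r m j p1 p2 p : tight_path h r m j -> p1 < m -> p2 < m -> p < m ->
  G (r p1) (h 1) -> G (r p2) (h j.+1) -> ~~ G (r p) (h j.-1).
Proof.
move=> tp p1m p2m pm a1 a2; have [hh rr tt h0 hj range] := tp; have om := tp_odd tp.
have rC := rr.2.
have clq q i l (qm : q < m) := @attached_clique h (r q) i l hh (rC q qm).
have one q : q < m -> G (r q) (h 1) -> q = 0.
  move=> qm q1; have := tt q p2 1 j.+1; rewrite /opair /cadj => H.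
  case: (H qm p2m _ _ _ q1 a2); try rim_lia.
  move=> [qE _]; rewrite qE in qm q1.
  by have := clq _ 1 j qm _ _ q1 hj; rewrite /cadj; case=> //; rim_lia.
have p10 := one _ p1m a1; rewrite {p1 p1m}p10 in a1.
have two q : q < m -> G (r q) (h j.+1) -> q = m.-1.
  move=> qm q1; have := tt 0 q 1 j.+1; rewrite /opair /cadj => H.
  by case: (H _ qm _ _ _ a1 q1); rim_lia.
have p2E := two _ p2m a2; rewrite {p2 p2m}p2E in a2.
apply/negP => aj.
have [j3|j3] := eqVneq j 3; last first.
  have := tt 0 p 1 j.-1; rewrite /opair /cadj => H.
  case: (H _ pm _ _ _ a1 aj); try rim_lia.
  move=> [_ pE]; rewrite pE in pm aj.
  by have := clq _ j.-1 j.+1 pm _ _ aj a2; rewrite /cadj; case=> //; rim_lia.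
subst j; rewrite /= in aj.
have [f [fm af] fmin] : exists2 f, f < m /\ G (r f) (h 2) & forall q, q < f -> ~~ G (r q) (h 2).
  have ex : exists f, (f < m) && G (r f) (h 2) by exists p; rewrite pm.
  case: (ex_minnP ex) => f /andP[fm af] fmin; exists f => // q qf; apply/negP => aq.
  by have := fmin q; rewrite aq (ltn_trans qf fm) => /(_ isT); rewrite leqNgt qf.
have rrf := cpath_sub rr (_ : 0 + f.+1 <= m).
have of_ : odd f.+1.
  apply: (odd_apex (i := 0) (j := 2) hh (rrf _)); rewrite /cadj; try rim_lia.
  + by move=> q qf; rewrite add0n; apply/idP/eqP => [/(tp_zero tp)|->//]; apply; rim_lia.
  + move=> q qf; rewrite add0n; apply/idP/eqP => [aq|->//].
    have := fmin q; rewrite aq; have := ltngtP q f; case=> //; rim_lia.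
have f0 : f != 0.
  apply: contraTneq af => f0; rewrite f0 in fm *; apply/negP => af.
  have := clq _ 0 2 fm _ _ h0 af; rewrite /cadj; case=> //; rim_lia.
suff : ~~ odd (2 + f.+1) by rim_lia.
apply: (even_arc (i := 1) hh (rrf _)); try rim_lia.
move=> [|[|l]] // q _ qf; rewrite add0n /= ?add1n ?orbF.
  by apply/idP/eqP => [/one|->//]; apply; rim_lia.
apply/idP/eqP => [aq|->//].
by have := fmin q; rewrite aq; have := ltngtP q f; case=> //; rim_lia.
Qed.

Lemma tp_opposite h r m j p1 p2 : tight_path h r m j -> p1 < m -> p2 < m ->
  G (r p1) (h 1) -> G (r p2) (h j.+1) -> two_edges h r m 0 j.
Proof.
move=> tp p1m p2m a1 a2; have [hh rr tt h0 hj range] := tp.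
have one q : q < m -> G (r q) (h 1) -> q = 0.
  move=> qm q1; have := tt q p2 1 j.+1; rewrite /opair /cadj => H.
  case: (H qm p2m _ _ _ q1 a2); try rim_lia.
  move=> [qE _]; rewrite qE in qm q1.
  by have := attached_clique hh (rr.2 _ qm) _ _ q1 hj; rewrite /cadj; case=> //; rim_lia.
have p10 := one _ p1m a1; rewrite {p1}p10 in a1 p1m.
have two q : q < m -> G (r q) (h j.+1) -> q = m.-1.
  move=> qm q1; have := tt 0 q 1 j.+1; rewrite /opair /cadj => H.
  by case: (H p1m qm _ _ _ a1 q1); rim_lia.
have p2E := two _ p2m a2; rewrite {p2}p2E in a2 p2m.
have nj p : p < m -> G (r p) (h j.-1) = false.
  by move=> pm; apply/negbTE; apply: (tp_diagonal tp p1m p2m pm a1 a2).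
have nN p : p < m -> G (r p) (h N.-1) = false.
  move=> pm; apply/negbTE.
  (* Reversal exchanges the roles of 1 and [j.+1] and replaces [j.-1] by [N.-1]. *)
  have := @tp_diagonal _ _ _ _ 0 m.-1 (m.-1 - p) (tp_rev tp) p1m p2m.
  rewrite /= subn0 subnn (_ : m.-1 - (m.-1 - p) = p); last by rim_lia.
  have -> : rot j 1 = j.+1 by rewrite /rot addn1 ifT //; rim_lia.
  have -> : rot j (N - j).+1 = 1 by rewrite /rot; case: (ltnP (j + (N - j).+1) N) => ?; rim_lia.
  have -> : rot j (N - j).-1 = N.-1 by rewrite /rot; case: (ltnP (j + (N - j).-1) N) => ?; rim_lia.
  by apply=> //; rim_lia.
move=> p l pm lN; rewrite /sedge; apply/idP/idP => [pl|].
  have six := tp_six tp pm lN pl.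
  case/or3P: six => [/eqP E|/eqP E|/or4P[] /eqP E]; rewrite ?E in pl *.
  - by rewrite (tp_zero tp pm pl).
  - by rewrite (one _ pm pl).
  - by move: pl; rewrite (_ : l = N.-1) ?nN // -E.
  - by rewrite (tp_last tp pm pl) !eqxx orbT.
  - by move: pl; rewrite (_ : l = j.-1) ?nj // -E.
  - by rewrite (two _ pm pl) !eqxx !orbT.
case/orP => /andP[/eqP -> ll].
  by have [->|->] : l = 0 \/ l = 1 by rim_lia.
by have [->|->] : l = j \/ l = j.+1 by rim_lia.
Qed.

Definition nbr_pred h r m i : pred nat := fun p => (p < m) && G (r p) (h i).

Lemma tp_half_alternation h r m j : tight_path h r m j ->
  (forall p, p < m -> G (r p) (h j.+1) = false) -> (forall p, p < m -> G (r p) (h j.-1) = false) ->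
  alternation (nbr_pred h r m 1) (nbr_pred h r m N.-1) /\
  forall p, nbr_pred h r m 1 p -> (forall q, p < q -> ~~ nbr_pred h r m 1 q) -> ~~ odd p.
Proof.
move=> tp nj1 nj; have [hh rr tt h0 hj range] := tp; have om := tp_odd tp.
split; first split.
- move=> p /andP[pm p1]; apply/negP => /andP[_ pN].
  by have := attached_clique hh (rr.2 _ pm) _ _ p1 pN; rewrite /cadj; case=> //; rim_lia.
- move=> p /andP[pm p1] pmin.
  have [->|p0] := eqVneq p 0; [by left | right].
  have rrp := cpath_sub rr (_ : 0 + p.+1 <= m).
  suff : ~~ odd (2 + p.+1) by rim_lia.
  apply: (even_arc (i := 0) hh (rrp _)); try rim_lia.
  move=> [|[|l]] // q _ qp; rewrite !add0n /= ?orbF.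
    by apply/idP/eqP => [/(tp_zero tp)|->//]; apply; rim_lia.
  apply/idP/eqP => [q1|->//]; have := pmin q; rewrite /nbr_pred q1 andbT.
  by rim_lia.
- move=> p q pq /andP[pm p1] /andP[qm q1] none.
  have [->|qp] := eqVneq q p.+1; [by left | right].
  have rrp := cpath_sub rr (_ : p + (q - p).+1 <= m).
  suff : ~~ odd (1 + (q - p).+1) by rim_lia.
  apply: (even_arc (i := 1) hh (rrp _)); try rim_lia.
  move=> [|l] // x _ xq; rewrite addn0 /=.
  have [->|x0] := eqVneq x 0; first by rewrite addn0 p1.
  have [->|xq'] := eqVneq x (q - p); first by rewrite subnKC ?q1 //; rim_lia.
  have := none (p + x); rewrite /nbr_pred; case: (G (r (p + x)) (h 1)) => //.
  by rim_lia.
- move=> p q pq /andP[pm p1] /andP[qm qN] none.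
  have rrp := cpath_sub rr (_ : p + (q - p).+1 <= m).
  suff : odd (q - p).+1 by rim_lia.
  apply: (odd_apex (i := 1) (j := N.-1) hh (rrp _)); rewrite /cadj; try rim_lia.
  + move=> x xq; apply/idP/eqP => [a|->]; last by rewrite addn0.
    have [->//|x0] := eqVneq x 0.
    have [xq'|xq'] := eqVneq x (q - p).
      rewrite xq' subnKC in a; last by rim_lia.
      by have := attached_clique hh (rr.2 _ qm) _ _ a qN; rewrite /cadj; case=> //; rim_lia.
    by have := none (p + x); rewrite /nbr_pred a; rim_lia.
  + move=> x xq; apply/idP/eqP => [a|->]; last by rewrite /= subnKC //; rim_lia.
    have [//|xq'] := eqVneq x (q - p).
    have [x0|x0] := eqVneq x 0.
      rewrite x0 addn0 in a.
      by have := attached_clique hh (rr.2 _ pm) _ _ p1 a; rewrite /cadj; case=> //; rim_lia.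
    by have := none (p + x); rewrite /nbr_pred a; rim_lia.
- move=> p /andP[pm p1] pmax.
  have rrp := cpath_sub rr (_ : p + (m - p) <= m).
  suff : odd (m - p) by rim_lia.
  apply: (odd_apex (i := 1) (j := j) hh (rrp _)); rewrite /cadj; try rim_lia.
  + move=> x xq; apply/idP/eqP => [a|->]; last by rewrite addn0.
    by have := pmax (p + x); rewrite /nbr_pred a; rim_lia.
  + move=> x xq; apply/idP/eqP => [/(tp_last tp)|->]; first by rim_lia.
    by rewrite (_ : p + (m - p).-1 = m.-1) //; rim_lia.
Qed.

(** By [tp_side] and [tp_side'] each arc between 0 and [j] carries an attachment, so both [h 1] and
    [h N.-1] have contacts. Reflection supplies the second half of the alternation. *)
Lemma tp_not_around h r m j : tight_path h r m j ->
  (forall p, p < m -> G (r p) (h j.+1) = false) -> (forall p, p < m -> G (r p) (h j.-1) = false) -> False.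
Proof.
move=> tp nj1 nj; have rg := tp_range tp.
have [aXY lX] := tp_half_alternation tp nj1 nj.
have E1 : flip (N - j).+1 = j.-1 by rewrite /flip; rim_lia.
have E2 : flip (N - j).-1 = j.+1 by rewrite /flip; case E: (N - j).-1 => [|d]; rim_lia.
have E3 : flip 1 = N.-1 by rewrite /flip subn1.
have E4 : flip N.-1 = 1 by rewrite /flip; case E: N.-1 => [|d]; rim_lia.
have X1 : nbr_pred (h \o flip) r m 1 = nbr_pred h r m N.-1 by rewrite -E3.
have X2 : nbr_pred (h \o flip) r m N.-1 = nbr_pred h r m 1 by rewrite -[in RHS]E4.
have [||aYX lY] := tp_half_alternation (tp_flip tp).
- by move=> p pm; have := nj p pm; rewrite -{1}E1.
- by move=> p pm; have := nj1 p pm; rewrite -{1}E2.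
rewrite X1 X2 in aYX; rewrite X1 in lY.
apply: (alternation_absurd aXY aYX lX lY (m := m)) => [p /orP[] /andP[]//||].
  by have [p pm] := tp_side tp; rewrite nj // orbF => p1; exists p; rewrite /nbr_pred pm.
by have [p pm] := tp_side' tp; rewrite nj1 // orbF => p1; exists p; rewrite /nbr_pred pm.
Qed.

(** Each of the two arcs between 0 and [j] has an attachment next to 0 or next to [j]. If these
    occur at different ends, [tp_opposite] applies, possibly after reflection; if both occur at the
    same end, [tp_not_around] yields one at the other end. *)
Lemma tp_two_edges h r m j : tight_path h r m j ->
  two_edges h r m 0 j \/ two_edges h r m N.-1 j.-1.
Proof.
move=> tp; have rg := tp_range tp.
have [p1 p1m] := tp_side tp; have [p2 p2m] := tp_side' tp.
have swap : (exists2 p, p < m & G (r p) (h j.-1)) -> (exists2 p, p < m & G (r p) (h N.-1)) ->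
    two_edges h r m N.-1 j.-1.
  move=> [p pm pj] [q qm qN].
  have te : two_edges (h \o flip) r m 0 (N - j).
    apply: (tp_opposite (tp_flip tp) qm pm); first by rewrite /= subn1.
    by rewrite (_ : (h \o flip) (N - j).+1 = h j.-1) //=; congr h; rim_lia.
  move=> x l xm lN; have := te x (flip l) xm (flip_lt lN).
  have -> : (h \o flip) (flip l) = h l.
    by rewrite /= /flip; case: l lN => [|l] lN //; case E: (N - l.+1) => [|d]; [rim_lia | congr h; rim_lia].
  have [N1 j1] : N.-1 < N /\ j.-1 < N by split; rim_lia.
  have E1 : flip (nx N.-1) = 0 by rewrite /nx prednK ?eqxx //; rim_lia.
  have E2 : flip (nx j.-1) = N - j.
    by rewrite /nx prednK ?ifF; case: {+}j rg => [|d]; rewrite /flip; rim_lia.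
  by move=> ->; rewrite -(sedge_flip N1 lN) -(sedge_flip j1 lN) E1 E2.
have opp p q : p < m -> q < m -> G (r p) (h 1) -> G (r q) (h j.+1) -> two_edges h r m 0 j.
  exact: tp_opposite tp.
case/orP => a2 /orP[] a1; [|right|left|].
- apply: NNPP => none; apply: (tp_not_around tp) => p pm; apply/negP => a; apply: none.
    by left; apply: (opp p1 p).
  by right; apply: swap; [exists p | exists p2].
- by apply: swap; [exists p1 | exists p2].
- exact: (opp p1 p2).
- apply: NNPP => none; apply: (tp_not_around (tp_rev tp)) => p pm; apply/negP => /=.
    have -> : rot j (N - j).+1 = 1 by rewrite /rot; case: (ltnP (j + (N - j).+1) N) => ?; rim_lia.
    by move=> a; apply: none; left; apply: (opp (m.-1 - p) p2) => //; rim_lia.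
  have -> : rot j (N - j).-1 = N.-1 by rewrite /rot; case: (ltnP (j + (N - j).-1) N) => ?; rim_lia.
  by move=> a; apply: none; right; apply: swap; [exists p1 | exists (m.-1 - p) => //; rim_lia].
Qed.

Lemma rot_surj a l : a < N -> l < N -> exists2 x, x < N & rot a x = l.
Proof.
move=> aN lN; exists (if a <= l then l - a else l + N - a).
  by case: (leqP a l) => ?; lia.
by rewrite /rot; case: (leqP a l) => ?; [rewrite ifT | rewrite ifF]; lia.
Qed.

Lemma two_edges_rot a h r m i j : a < N -> i < N -> j < N ->
  two_edges (h \o rot a) r m i j -> two_edges h r m (rot a i) (rot a j).
Proof.
move=> aN iN jN te p l pm lN; have [x xN <-] := rot_surj aN lN.
by rewrite !sedge_rot // -te.
Qed.

Lemma opairC i j : opair i j = opair j i.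
Proof. by rewrite /opair /cadj; lia. Qed.

(** Choose an attached opposite pair whose contacts are closest along the path. The subpath between
    them is tight, since any other such pair inside it is at least as far apart. *)
Lemma two_edges_exist h r M p q i j : rim h -> cpath r M -> p < M -> q < M -> i < N -> j < N ->
    opair i j -> G (r p) (h i) -> G (r q) (h j) ->
  exists p0 m i0 j0, [/\ [&& p0 + m <= M, odd m, 1 < m, i0 < N & j0 < N], opair i0 j0 &
    two_edges h (fun x => r (p0 + x)) m i0 j0].
Proof.
move=> hh rr.
pose P s := exists p i j, [/\ p + s < M, i < N, j < N, opair i j & G (r p) (h i) /\ G (r (p + s)) (h j)].
have Pin a b x y : a < M -> b < M -> x < N -> y < N -> opair x y -> G (r a) (h x) -> G (r b) (h y) ->
    P (maxn a b - minn a b).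
  move=> aM bM xN yN xy ax by_; have [ab|ab] := leqP a b.
    by exists a, x, y; rewrite subnKC.
  by exists b, y, x; rewrite opairC subnKC // ltnW.
move=> pM qM iN jN ij pi qj.
have [s [a [x [y [asM xN yN xy [ax ay]]]]] smin] := nat_min (ex_intro _ _ (Pin _ _ _ _ pM qM iN jN ij pi qj)).
have [z zN zE] := rot_surj xN yN.
have x0 : rot x 0 = x by rewrite /rot addn0 xN.
have oz : opair 0 z by rewrite -(opair_rot xN) ?x0 ?zE //; rim_lia.
have tp : tight_path (h \o rot x) (fun b => r (a + b)) s.+1 z.
  split.
  - exact: rim_rot.
  - by apply: cpath_sub rr _; rim_lia.
  - move=> b c i' j' bs cs i'N j'N oij bi cj.
    have := smin _ (Pin (a + b) (a + c) _ _ _ _ (rot_lt xN i'N) (rot_lt xN j'N) _ bi cj).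
    rewrite opair_rot // => /(_ _ _ oij) H; have := H _ _; rim_lia.
  - by rewrite addn0 /= x0.
  - by rewrite /= zE.
  - have s0 : s != 0.
      apply: contraTneq ay => s0; rewrite s0 addn0 in asM *; apply/negP => ay.
      have [E|E] := attached_clique hh (rr.2 _ asM) xN yN ax ay; move: xy; rewrite /opair.
        by rewrite E; rim_lia.
      by rewrite E andbF.
    by move: oz; rewrite /opair /cadj; rim_lia.
have om := tp_odd tp; have rg := tp_range tp.
have [te|te] := tp_two_edges tp.
  exists a, s.+1, (rot x 0), (rot x z); rewrite !rot_lt ?opair_rot //; try rim_lia; split=> //; try rim_lia.
  by apply: two_edges_rot te; rim_lia.
exists a, s.+1, (rot x N.-1), (rot x z.-1); rewrite !rot_lt ?opair_rot //; try rim_lia; split=> //; try rim_lia.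
  by move: oz; rewrite /opair /cadj; rim_lia.
by apply: two_edges_rot te; rim_lia.
Qed.

(** * The set of rim vertices attached to an arbitrary path *)

Definition att h r M l := [exists p : 'I_M, G (r p) (h l)].

Lemma attP h r M l : reflect (exists2 p, p < M & G (r p) (h l)) (att h r M l).
Proof.
apply: (iffP existsP) => [[p pl]|[p pM pl]]; first by exists p.
by exists (Ordinal pM).
Qed.

Definition edge_pair (X : pred nat) :=
  exists i j, [/\ i < N, j < N, opair i j & forall l, l < N -> X l = sedge i l || sedge j l].

(** What survives of the two-edge structure for paths in [C] that are not shortest; [tame_path]
    establishes it for all of them. *)
Definition tame (X : pred nat) :=
  (forall i j, i < N -> j < N -> X i -> X j -> ~~ opair i j) \/ edge_pair X.

Lemma tame_pair (X : pred nat) i j : i < N -> j < N -> opair i j -> X i -> X j -> tame X -> edge_pair X.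
Proof. by move=> iN jN ij Xi Xj [H|//]; have := H _ _ iN jN Xi Xj; rewrite ij. Qed.

(** In either direction round the rim, [a] and [b] are an odd number of steps apart, at least 3, so
    no rim edge joins the two edges and there is no room for a third one. *)
Lemma edge_pair_start a b i i' : a < N -> b < N -> opair a b -> i < N -> i' < N ->
  i' != i -> sedge i i' -> sedge a i || sedge b i -> sedge a i' || sedge b i' -> i = a \/ i = b.
Proof.
move=> aN bN /andP[oab ncab] iN i'N i'i.
rewrite !sedge_nx // (negbTE i'i) /= => /eqP ii' Ei Ei'.
have [ia|ia] := eqVneq i a; first by left.
have [ib|ib] := eqVneq i b; first by right.
exfalso; have key x y : x < N -> y < N -> odd (x + y) -> y != nx x -> i = nx x ->
    [|| i' == x, i' == nx x, i' == y | i' == nx y] -> False.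
  move=> xN yN oxy xy ix; rewrite ii' ix => /or4P[]; first by rewrite (negbTE (nx_nx x)).
  - by rewrite -ix -ii' (negbTE i'i).
  - by move/eqP=> yE; move: oxy; rewrite -yE oddD !odd_nx ?nx_lt // negbK addbb.
  - by rewrite nx_inj ?nx_lt // eq_sym (negbTE xy).
have [ab ba] : b != nx a /\ a != nx b by move: ncab; rewrite cadj_nx // negb_or => /andP[].
move: Ei Ei'; rewrite (negbTE ia) (negbTE ib) /= => /orP[] /eqP iE Ei'.
  by apply: (key a b) => //; move: Ei'; rewrite -!orbA.
by apply: (key b a) => //; [rewrite addnC | move: Ei'; rewrite orbC -!orbA].
Qed.

Lemma sedge_next i : i < N -> exists2 y, y < N & sedge i y && (y != i).
Proof.
move=> iN; exists (if i.+1 == N then 0 else i.+1); case: (i.+1 =P N) => ?; rewrite /sedge; lia.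
Qed.

Lemma edge_pair_unique (X : pred nat) i j : i < N -> j < N -> opair i j -> edge_pair X ->
  (forall l, l < N -> sedge i l || sedge j l -> X l) ->
  forall l, l < N -> X l = sedge i l || sedge j l.
Proof.
move=> iN jN ij [a [b [aN bN ab XE]]] sub l lN.
have st x : x < N -> (forall l, l < N -> sedge x l -> X l) -> x = a \/ x = b.
  move=> xN H; have [y yN /andP[xy yx]] := sedge_next xN.
  apply: (edge_pair_start aN bN ab xN yN yx xy); rewrite -XE //; apply: H => //.
  by rewrite /sedge eqxx.
have [||] := st i iN; first by move=> x xN ix; apply: sub; rewrite // ix.
- move=> ia; have [||jb] := st j jN; first by move=> x xN jx; apply: sub; rewrite // jx orbT.
    by move=> ja; move: ij; rewrite ia ja /opair; lia.
  by rewrite XE // ia jb.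
- move=> ib; have [||jb] := st j jN; first by move=> x xN jx; apply: sub; rewrite // jx orbT.
    by move=> ja; rewrite XE // ja ib orbC.
  by move: ij; rewrite ib jb /opair; lia.
Qed.

Lemma edge_pair_at (X : pred nat) i : i < N -> (forall l, l < N -> sedge i l -> X l) ->
  edge_pair X -> exists b, [/\ b < N, opair i b & forall l, l < N -> X l = sedge i l || sedge b l].
Proof.
move=> iN H [a [b [aN bN ab XE]]]; have [y yN /andP[iy yi]] := sedge_next iN.
have Xi : sedge a i || sedge b i by rewrite -XE // H // /sedge eqxx.
have Xy : sedge a y || sedge b y by rewrite -XE // H.
have [ia|ib] := edge_pair_start aN bN ab iN yN yi iy Xi Xy.
  by exists b; rewrite ia.
by exists a; rewrite ib opairC; split=> // l lN; rewrite XE // orbC.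
Qed.

(** The path without its last vertex is tame and attached to 0, 1 and [d], so [j] and [j.+1] are
    attached to the last vertex only. If [r 0] is attached to an even [e] between 1 and [j], the
    hole through [h e], [v], [h j.+1] and the hole along the arc from [e] to [j] give [l + m]
    different parities. If [d] is odd, tameness forces [d.+1] to be attached as well, which only
    [r 0] can achieve, and [d.+1] serves as [e]. *)
Lemma path_core h r l m j d : rim h -> cpath r (l + m) -> 0 < l ->
    [&& odd j, 2 < j, j + 2 < N, odd m & 1 < m] -> two_edges h (fun x => r (l + x)) m 0 j ->
    (forall p x, 0 < p < l -> x < N -> G (r p) (h x) -> sedge 0 x || sedge j x) ->
    1 < d < j -> G (r 0) (h d) -> tame (att h r (l + m).-1) -> False.
Proof.
move=> hh rr l0 range te inner dj a0 tX; pose X := att h r (l + m).-1.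
have tail p x : l <= p -> p < l + m -> x < N ->
    G (r p) (h x) = (p == l) && sedge 0 x || (p == (l + m).-1) && sedge j x.
  move=> lp plm xN; have := te (p - l) x; rewrite subnKC // => ->; rewrite ?xN //; first last.
    by rim_lia.
  by congr (_ && _ || _ && _); rim_lia.
have X01 x : x < N -> sedge 0 x -> X x.
  by move=> xN x0; apply/attP; exists l; [rim_lia | rewrite tail ?eqxx ?x0 //; rim_lia].
have X0 : X 0 by apply: X01 => //; rim_lia.
have X1 : X 1 by apply: X01; rewrite /sedge; rim_lia.
have Xd : X d by apply/attP; exists 0 => //; rim_lia.
have form i k : i < N -> k < N -> X i -> X k -> opair i k ->
    exists b, [/\ [&& odd b, 2 < b & b + 2 < N] & forall x, x < N -> X x = sedge 0 x || sedge b x].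
  move=> iN kN Xi Xk ik; have N0 : 0 < N by rim_lia.
  have [b [bN ob XE]] := edge_pair_at N0 X01 (tame_pair iN kN ik Xi Xk tX).
  by exists b; split=> //; move: ob; rewrite /opair /cadj; rim_lia.
have [N0 N1 jN j1N] : [/\ 0 < N, 1 < N, j < N & j.+1 < N] by split; rim_lia.
have dN : d < N by rim_lia.
have nXj : ~ X j.
  move=> Xj; have oj : opair 0 j by rewrite /opair /cadj; rim_lia.
  have [b [rb XE]] := form 0 j N0 jN X0 Xj oj.
  by move: Xj Xd; rewrite !XE // /sedge; rim_lia.
have nXj1 : ~ X j.+1.
  move=> Xj; have oj : opair 1 j.+1 by rewrite /opair /cadj; rim_lia.
  have [b [rb XE]] := form 1 j.+1 N1 j1N X1 Xj oj.
  by move: Xj Xd; rewrite !XE // /sedge; rim_lia.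
have even_core e : G (r 0) (h e) -> 1 < e < j -> ~~ odd e -> False.
  move=> ae ej ee; have rC := rr.2.
  have clq x : x < N -> G (r 0) (h x) -> x = e \/ cadj N x e.
    by move=> xN ax; apply: attached_clique hh (rC 0 _) _ _ ax ae; rim_lia.
  have Xe : X e by apply/attP; exists 0 => //; rim_lia.
  have ne : ~~ G (r 0) (h e.+1).
    apply/negP => ae1; have Xe1 : X e.+1 by apply/attP; exists 0 => //; rim_lia.
    have [ej1|ej1] := eqVneq e.+1 j; first by apply: nXj; rewrite -ej1.
    have e1N : e.+1 < N by rim_lia.
    have oe : opair 0 e.+1 by rewrite /opair /cadj; rim_lia.
    have [b [rb XE]] := form 0 e.+1 N0 e1N X0 Xe1 oe.
    by move: Xe1 Xe; rewrite !XE // /sedge; rim_lia.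
  have olm : odd (l + m).
    apply: (odd_apex (i := e) (j := j.+1) hh rr); rewrite /cadj; try rim_lia.
    + move=> p plm; apply/idP/eqP => [ap|->//].
      have [lp|pl] := leqP l p.
        by move: ap; rewrite tail //; [rewrite /sedge; rim_lia | rim_lia].
      have [//|p0] := posnP p; have := inner p e; rewrite p0 pl ap /sedge; rim_lia.
    + move=> p plm; apply/idP/eqP => [ap|->]; last first.
        by rewrite tail; rewrite /sedge; rim_lia.
      have [//|pne] := eqVneq p (l + m).-1.
      by case: nXj1; apply/attP; exists p => //; rim_lia.
  suff : ~~ odd ((j - e).+1 + (l + m)) by rim_lia.
  apply: (even_arc (i := e) hh rr); try rim_lia.
  move=> y p yj plm.
  have yN : e + y < N by rim_lia.
  have [lp|pl] := leqP l p.
    have s0 : sedge 0 (e + y) = false by rewrite /sedge; rim_lia.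
    have sj : sedge j (e + y) = (y == (j - e).+1.-1) by rewrite /sedge; rim_lia.
    have p0 : (p == 0) = false by rim_lia.
    by rewrite tail // s0 sj p0 !andbF andbC.
  have [p0|p0] := posnP p.
    have -> : (y == 0) && true || (y == (j - e).+1.-1) && (p == (l + m).-1) = (y == 0) by rim_lia.
    rewrite p0; apply/idP/eqP => [ay|->]; last by rewrite addn0.
    have [y1|y1] := eqVneq y 1; first by move: ay ne; rewrite y1 addn1 => ->.
    by have := clq _ yN ay; rewrite /cadj; case=> //; rim_lia.
  have -> : G (r p) (h (e + y)) = false; last by rim_lia.
  apply/negP => ap; have := inner p _ _ yN ap; rewrite p0 pl /sedge => /(_ isT).
  move=> ej'; case: nXj.
  by apply/attP; exists p; [rim_lia | rewrite (_ : j = e + y) //; rim_lia].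
have [od|ed] := boolP (odd d); last by apply: even_core a0 dj ed.
have o_d : opair 0 d by rewrite /opair /cadj; rim_lia.
have [b [rb XE]] := form 0 d N0 dN X0 Xd o_d.
(* Both are odd, so [d] is the first end of its edge. *)
have bd : b = d by move: Xd; rewrite XE /sedge; rim_lia.
have d1N : d.+1 < N by rim_lia.
have : X d.+1 by rewrite XE // bd /sedge; rim_lia.
case/attP => p plm ap; have [lp|pl] := leqP l p.
  by move: ap; rewrite tail // /sedge; rim_lia.
have [p0|p0] := posnP p; first by rewrite p0 in ap; apply: even_core ap _ _; rim_lia.
by have := inner p _ _ d1N ap; rewrite p0 pl /sedge => /(_ isT); rim_lia.
Qed.

(* Up to a symmetry of the rim the two edges are 01 and j(j+1) and d lies between them. *)
Lemma normalize h i j d : rim h -> i < N -> j < N -> d < N -> opair i j ->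
    ~~ (sedge i d || sedge j d) ->
  exists s j' d', [/\ rim (h \o s), [&& odd j', 2 < j' & j' + 2 < N], 1 < d' < j', s d' = d &
    forall x, x < N -> [/\ s x < N, sedge i (s x) = sedge 0 x & sedge j (s x) = sedge j' x]].
Proof.
move=> hh iN jN dN ij nd.
have N0 : 0 < N by rim_lia.
have [a aN aE] := rot_surj iN jN; have [b bN bE] := rot_surj iN dN.
have i0 : rot i 0 = i by rewrite /rot addn0 iN.
have oa : opair 0 a by rewrite -(opair_rot iN) // i0 aE.
have nb : ~~ (sedge 0 b || sedge a b).
  by rewrite -(sedge_rot iN N0 bN) -(sedge_rot iN aN bN) i0 aE bE.
have ra : [&& odd a, 2 < a & a + 2 < N] by move: oa; rewrite /opair /cadj; rim_lia.
have [ba|ab] := ltnP b a.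
  exists (rot i), a, b; split=> //; [exact: rim_rot | by move: nb; rewrite /sedge; rim_lia |].
  move=> x xN; rewrite rot_lt //; split=> //; first by rewrite -{1}i0 sedge_rot.
  by rewrite -{1}aE sedge_rot.
have tE x : x < N -> rot 1 (flip x) = if x <= 1 then 1 - x else N.+1 - x.
  move=> xN; rewrite /rot /flip; case: x xN => [|[|x]] xN.
  - by rewrite ifT /=; rim_lia.
  - by rewrite ifF /=; rim_lia.
  - by rewrite ifT /=; rim_lia.
have tN x : x < N -> rot 1 (flip x) < N by move=> xN; rewrite rot_lt ?flip_lt //; rim_lia.
exists (rot i \o (rot 1 \o flip)), (N - a), (N.+1 - b).
have b'N : N.+1 - b < N by move: nb; rewrite /sedge; rim_lia.
split.
- have -> : h \o (rot i \o (rot 1 \o flip)) = ((h \o rot i) \o rot 1) \o flip by [].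
  by apply: rim_flip; apply: rim_rot; [rim_lia | apply: rim_rot].
- by rim_lia.
- by move: nb; rewrite /sedge; rim_lia.
- rewrite /= tE // ifF; last by move: nb; rewrite /sedge; rim_lia.
  by rewrite -bE; congr rot; rim_lia.
- move=> x xN; rewrite /= rot_lt ?tN //; split=> //.
    rewrite -{1}i0 sedge_rot ?tN // tE // /sedge.
    by case: (leqP x 1) => ?; rim_lia.
  rewrite -{1}aE sedge_rot ?tN // tE // /sedge.
  by case: (leqP x 1) => ?; rim_lia.
Qed.

Lemma path_step h r l m i j d : rim h -> cpath r (l + m) -> 0 < l -> i < N -> j < N -> d < N ->
    opair i j -> odd m && (1 < m) -> two_edges h (fun x => r (l + x)) m i j ->
    (forall p x, 0 < p < l -> x < N -> G (r p) (h x) -> sedge i x || sedge j x) ->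
    ~~ (sedge i d || sedge j d) -> G (r 0) (h d) ->
    (forall h', rim h' -> tame (att h' r (l + m).-1)) -> False.
Proof.
move=> hh rr l0 iN jN dN ij rm te inner nd a0 tm.
have [s [j' [d' [hs rj dj sd sE]]]] := normalize hh iN jN dN ij nd.
apply: (@path_core (h \o s) r l m j' d') => //.
- by rim_lia.
- by move=> p x pm xN; have [sN s1 s2] := sE x xN; rewrite /= te // s1 s2.
- by move=> p x pl xN ax; have [sN s1 s2] := sE x xN; rewrite -s1 -s2; apply: inner pl sN ax.
- by rewrite /= sd.
- exact: tm.
Qed.

Lemma two_edges_rev h r m i j : two_edges h r m i j -> two_edges h (fun y => r (m.-1 - y)) m j i.
Proof.
move=> te p x pm xN; rewrite te //; last by rim_lia.
by rewrite orbC; congr (_ && _ || _ && _); rim_lia.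
Qed.

Lemma att_two_edges h r m i j : 0 < m -> two_edges h r m i j ->
  forall x, x < N -> att h r m x = sedge i x || sedge j x.
Proof.
move=> m0 te x xN; apply/attP/orP => [[p pm]|[ix|jx]].
- by rewrite te // => /orP[] /andP[_ ->]; [left|right].
- by exists 0; rewrite // te // eqxx ix.
- by exists m.-1; [rim_lia | rewrite te // ?eqxx ?jx ?orbT //; rim_lia].
Qed.

Lemma att_unique h r M p m i j : i < N -> j < N -> opair i j -> 0 < m -> p + m <= M ->
    two_edges h (fun x => r (p + x)) m i j -> tame (att h r M) ->
  forall x, x < N -> att h r M x = sedge i x || sedge j x.
Proof.
move=> iN jN ij m0 pM te tX.
have sub x : x < N -> sedge i x || sedge j x -> att h r M x.
  move=> xN; rewrite -(att_two_edges m0 te xN) => /attP[q qm ax].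
  by apply/attP; exists (p + q) => //; rim_lia.
apply: edge_pair_unique => //; apply: (tame_pair iN jN ij) tX; apply: sub => //.
  by rewrite /sedge eqxx.
by rewrite /sedge eqxx orbT.
Qed.

(** In a shortest counterexample there are a two-edge subpath and a vertex attached to some [d] off
    the two edges. Deleting an end of the path leaves a tame path, so the two together need the
    whole path: the subpath lies at one end and the extra contact is the other end, as [path_step]
    requires. *)
Lemma tame_path M h r : rim h -> cpath r M -> tame (att h r M).
Proof.
elim/ltn_ind: M h r => M IH h r hh rr; apply: NNPP => nt.
have [i [j [iN jN [/attP[p pM ai] /attP[q qM aj] ij]]]] : exists i j, [/\ i < N, j < N &
    [/\ att h r M i, att h r M j & opair i j]].
  apply: NNPP => H; apply: nt; left=> i j iN jN ai aj; apply/negP => ij; apply: H.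
  by exists i, j.
have [p0 [m [a [b [/and5P[pm om m1 aN bN] ab te]]]]] := two_edges_exist hh rr pM qM iN jN ij ai aj.
clear i j iN jN p pM ai q qM aj ij.
have m0 : 0 < m by rim_lia.
have [d [dN nd /attP[x xM ax]]] : exists d, [/\ d < N, ~~ (sedge a d || sedge b d) & att h r M d].
  apply: NNPP => H; apply: nt; right; exists a, b; split=> // l lN; apply/idP/idP => [al|].
    by apply/negPn/negP => nl; apply: H; exists l.
  rewrite -(att_two_edges m0 te lN) => /attP[q qm aq].
  by apply/attP; exists (p0 + q) => //; rim_lia.
have pre M' : M' < M -> p0 + m <= M' -> forall y z, y < M' -> z < N -> G (r y) (h z) ->
    sedge a z || sedge b z.
  move=> M'M pm' y z yM zN ay.
  have tX : tame (att h r M').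
    by apply: IH => //; apply: (cpath_sub (p := 0) rr); rim_lia.
  by rewrite -(att_unique aN bN ab m0 pm' te tX zN); apply/attP; exists y.
have suf y z : 0 < p0 -> 0 < y < M -> z < N -> G (r y) (h z) -> sedge a z || sedge b z.
  move=> p00 yM zN ay.
  have te' : two_edges h (fun x => r (1 + (p0.-1 + x))) m a b.
    by move=> u z' um zN'; rewrite (_ : 1 + (p0.-1 + u) = p0 + u) ?te //; rim_lia.
  have rs : cpath (fun x => r (1 + x)) M.-1 by apply: cpath_sub rr _; rim_lia.
  have pm' : p0.-1 + m <= M.-1 by rim_lia.
  have tX : tame (att h (fun x => r (1 + x)) M.-1) by apply: IH => //; rim_lia.
  rewrite -(att_unique aN bN ab m0 pm' te' tX zN).
  by apply/attP; exists y.-1; [rim_lia | rewrite (_ : 1 + y.-1 = y) //; rim_lia].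
have [p00|p00] := posnP p0; last first.
  have x0 : x = 0.
    by apply/eqP; apply: contraNT nd => x0; apply: (suf x) => //; rim_lia.
  have pmM : p0 + m = M.
    apply/eqP; rewrite eqn_leq pm leqNgt; apply/negP => lt.
    by case/negP: nd; apply: (pre M.-1 _ _ x) => //; rim_lia.
  subst M; rewrite x0 in ax.
  apply: (@path_step h r p0 m a b d) => //; first by rim_lia.
    by move=> q z qp zN; apply: suf => //; rim_lia.
  by move=> h' hh'; apply: IH => //; [rim_lia | apply: (cpath_sub (p := 0) rr); rim_lia].
have mM : m < M.
  rewrite ltn_neqAle; apply/andP; split; last by rim_lia.
  apply: contraNneq nd => mM; rewrite -(att_two_edges m0 te dN).
  by apply/attP; exists x; [rewrite mM | rewrite p00].
have xE : x = M.-1.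
  apply/eqP; apply: contraNT nd => xne; apply: (pre M.-1 _ _ x) => //; rim_lia.
(* Here the subpath comes first and the extra contact last; reversal restores the order expected by
   [path_step]. *)
have rv := cpath_rev rr.
apply: (@path_step h (fun y => r (M.-1 - y)) (M - m) m b a d) => //.
- by rewrite subnK //; rim_lia.
- by rim_lia.
- by rewrite opairC.
- by rim_lia.
- have := two_edges_rev te; move=> te' u z um zN; rewrite -te' // p00.
  by congr (G (r _) _); rim_lia.
- move=> u z ul zN; rewrite orbC; apply: (pre M.-1); rim_lia.
- by rewrite orbC.
- by rewrite subn0 -xE.
- move=> h' hh'; rewrite subnK; last by rim_lia.
  by apply: IH => //; [rim_lia | apply: (cpath_sub (p := 0) rv); rim_lia].
Qed.

(** [XS] belongs to a common leg, and each of two arms adds one edge. By tameness of [X1], an odd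
    element of [XS] between 1 and [j] comes with its successor, against [X2], whose second edge
    starts at an even index. So [d] is even, and unless [d = 2] and [j = 3], tameness adds the odd
    [d.-1] or [d.+1]. What remains is a single vertex between the edges 01 and 34. *)
Lemma tripod_core (X1 X2 XS : pred nat) j d : [&& odd j, 2 < j & j + 2 < N] -> 1 < d < j ->
    tame X1 -> tame X2 -> XS d ->
    (forall x, x < N -> X1 x = XS x || sedge 0 x) ->
    (forall x, x < N -> X2 x = XS x || sedge j x) ->
  [/\ j = 3, d = 2, ~~ XS 0 & ~~ XS 1].
Proof.
move=> rg dj t1 t2 Sd E1 E2; have N0 : 0 < N by lia.
have jN : j < N by lia.
have form1 i k : i < N -> k < N -> X1 i -> X1 k -> opair i k ->
    exists b, [/\ [&& odd b, 2 < b & b + 2 < N] & forall x, x < N -> X1 x = sedge 0 x || sedge b x].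
  move=> iN kN Xi Xk ik.
  have sub l : l < N -> sedge 0 l -> X1 l by move=> lN l0; rewrite E1 // l0 orbT.
  have [b [bN ob XE]] := edge_pair_at N0 sub (tame_pair iN kN ik Xi Xk t1).
  by exists b; split=> //; move: ob; rewrite /opair /cadj; rim_lia.
have form2 i k : i < N -> k < N -> X2 i -> X2 k -> opair i k ->
    exists b, [/\ ~~ odd b, b < N & forall x, x < N -> X2 x = sedge j x || sedge b x].
  move=> iN kN Xi Xk ik.
  have sub l : l < N -> sedge j l -> X2 l by move=> lN l0; rewrite E2 // l0 orbT.
  have [b [bN ob XE]] := edge_pair_at jN sub (tame_pair iN kN ik Xi Xk t2).
  by exists b; split=> //; move: ob; rewrite /opair /cadj; rim_lia.
have odd_no e : XS e -> 1 < e < j -> ~~ odd e.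
  move=> Se ej; apply/negP => oe.
  have [eN e1N j1N] : [/\ e < N, e.+1 < N & j.+1 < N] by split; rim_lia.
  have o1 : opair 0 e by rewrite /opair /cadj; rim_lia.
  have [b [rb XE]] := form1 0 e N0 eN ltac:(by rewrite E1 ?orbT) ltac:(by rewrite E1 ?Se) o1.
  have be : b = e by have := XE e eN; rewrite E1 // Se /sedge; rim_lia.
  have Se1 : XS e.+1.
    by have := XE e.+1 e1N; rewrite E1 // be; case: (XS e.+1) => //; rewrite /sedge; rim_lia.
  have o2 : opair e j.+1 by rewrite /opair /cadj; rim_lia.
  have [c [ec cN XE2]] := form2 e j.+1 eN j1N ltac:(by rewrite E2 ?Se)
    ltac:(by rewrite E2 // /sedge eqxx !orbT) o2.
  have := XE2 e eN; have := XE2 e.+1 e1N; rewrite !E2 // Se Se1 /sedge; rim_lia.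
have ed := odd_no d Sd dj.
have [d1N dN d2N] : [/\ d.+1 < N, d < N & d.-1 < N] by split; rim_lia.
have d2 : d = 2.
  apply: NNPP => d2; have o1 : opair 1 d by rewrite /opair /cadj; rim_lia.
  have N1 : 1 < N by rim_lia.
  have [b [rb XE]] := form1 1 d N1 dN ltac:(by rewrite E1 ?orbT) ltac:(by rewrite E1 ?Sd) o1.
  have be : b = d.-1 by have := XE d dN; rewrite E1 // Sd /sedge; rim_lia.
  have Se1 : XS d.-1.
    by have := XE d.-1 d2N; rewrite E1 // be; case: (XS d.-1) => //; rewrite /sedge; rim_lia.
  by have := odd_no _ Se1; rim_lia.
have j3 : j = 3.
  apply: NNPP => j3; have o1 : opair d j by rewrite /opair /cadj; rim_lia.
  have [c [ec cN XE2]] := form2 d j dN jN ltac:(by rewrite E2 ?Sd)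
    ltac:(by rewrite E2 // /sedge eqxx !orbT) o1.
  have cd : c = d by have := XE2 d dN; rewrite E2 // Sd /sedge; rim_lia.
  have Se1 : XS d.+1.
    by have := XE2 d.+1 d1N; rewrite E2 // cd; case: (XS d.+1) => //; rewrite /sedge; rim_lia.
  by have := odd_no _ Se1; rim_lia.
have S2 : X2 2 by rewrite E2 -?d2 ?Sd.
have no i : i < 2 -> ~~ XS i.
  move=> i2; apply/negP => Si; have iN : i < N by rim_lia.
  have Xi : X2 i by rewrite E2 // Si.
  have X3 : X2 3 by rewrite E2 ?j3 ?orbT //; rim_lia.
  have X4 : X2 4 by rewrite E2 ?j3 ?orbT //; rim_lia.
  have [k [kN Xk ik]] : exists k, [/\ k < N, X2 k & opair i k].
    have [->|->] : i = 0 \/ i = 1 by rim_lia.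
      by exists 3; rewrite /opair /cadj; split=> //; rim_lia.
    by exists 4; rewrite /opair /cadj; split=> //; rim_lia.
  have [c [ec cN XE2]] := form2 i k iN kN Xi Xk ik.
  have cj : c != 2.
    apply/eqP => c2; have := XE2 i iN; rewrite Xi c2 j3 /sedge; rim_lia.
  by have := XE2 2; have := XE2 i iN; rewrite Xi S2 j3 /sedge; rim_lia.
by split=> //; apply: no.
Qed.

(** The leg [s] from its far end towards [c], then [c] from the contact [f] back to its
    beginning. *)
Definition arm (c s : nat -> T) l f := fun y => if y < l then s (l.-1 - y) else c (f - (y - l)).

Lemma arm_att h c m s l f i j x : two_edges h c m i j -> f < m.-1 -> x < N ->
  att h (arm c s l f) (l + f.+1) x = att h s l x || sedge i x.
Proof.
move=> te fm xN; rewrite /arm; apply/attP/orP => [[y yt]|[/attP[p pl ap]|ix]].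
- case: ltnP => yl ay; [left; apply/attP; exists (l.-1 - y) => //; rim_lia | right].
  by move: ay; rewrite te //; [case/orP => /andP[]//; rim_lia | rim_lia].
- by exists (l.-1 - p); [rim_lia | rewrite ifT; [rewrite (_ : l.-1 - (l.-1 - p) = p) //; rim_lia | rim_lia]].
- exists (l + f); first by rim_lia.
  rewrite ifF; last by rim_lia.
  by rewrite (_ : f - (l + f - l) = 0) ?te ?ix //; rim_lia.
Qed.

Definition attaches c m s l := [/\ forall p y, p < l -> y < m -> s p <> c y,
  forall p y, 0 < p < l -> y < m -> ~~ G (s p) (c y) & exists2 y, y < m & G (s 0) (c y)].

(** Taking for [f] the first contact of [s 0] on [c] leaves no chord. *)
Lemma arm_path c m s l : cpath c m -> cpath s l -> 0 < l -> attaches c m s l ->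
  exists2 f, f < m & cpath (arm c s l f) (l + f.+1).
Proof.
move=> cc cs l0 [dis nadj [y0 y0m ay0]].
have ex : exists f, (f < m) && G (s 0) (c f) by exists y0; rewrite y0m.
case: (ex_minnP ex) => f /andP[fm af] fmin; exists f => //.
have fm1 : 0 + f.+1 <= m by rim_lia.
have rc := cpath_rev (cpath_sub cc fm1); have rs := cpath_rev cs.
have E : (fun y => if y < l then s (l.-1 - y) else c (0 + (f.+1.-1 - (y - l)))) = arm c s l f by [].
rewrite -E; split; last first.
  move=> p pt; case: ltnP => pl; first by apply: cs.2; rim_lia.
  by apply: cc.2; rim_lia.
apply: (ipath_cat l0 rs.1 rc.1) => p y pl yf; first by apply: dis; rim_lia.
rewrite add0n; have [pE|pE] := eqVneq p l.-1; last first.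
  by apply/negbTE; apply: nadj; rim_lia.
rewrite pE subnn; have [->|yn] := eqVneq y 0; first by rewrite subn0 /= af; rim_lia.
apply/negbTE/negP => a; have := fmin (f.+1.-1 - y); rewrite a andbT; rim_lia.
Qed.

Lemma attaches_rev c m s l : attaches c m s l -> attaches (fun y => c (m.-1 - y)) m s l.
Proof.
move=> [dis nadj [y ym ay]]; split.
- by move=> p x pl xm; apply: dis => //; rim_lia.
- by move=> p x pl xm; apply: nadj => //; rim_lia.
- by exists (m.-1 - y); [rim_lia | rewrite (_ : m.-1 - (m.-1 - y) = y) //; rim_lia].
Qed.

(* Otherwise the arm contains all of c, hence attaches to both edges and to d, against [tame_path]. *)
Lemma arm_short h c m s l f i j d : rim h -> two_edges h c m i j -> cpath (arm c s l f) (l + f.+1) ->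
    f < m -> 1 < m -> 0 < l -> i < N -> j < N -> opair i j -> d < N ->
    ~~ (sedge i d || sedge j d) -> G (s l.-1) (h d) ->
  f < m.-1.
Proof.
move=> hh te rr fm m1 l0 iN jN ij dN nd ad; rewrite ltnNge; apply/negP => mf.
have fE : f = m.-1 by rim_lia.
have tX := tame_path hh rr.
have te' : two_edges h (fun x => arm c s l f (l + x)) m j i.
  move=> p x pm xN; rewrite -(two_edges_rev te) // /arm ifF; last by rim_lia.
  by rewrite fE; congr (G (c _) _); rim_lia.
have le : l + m <= l + f.+1 by rim_lia.
have m0 : 0 < m by rim_lia.
have ji : opair j i by rewrite opairC.
case/negP: nd; rewrite orbC -(att_unique jN iN ji m0 le te' tX dN).
by apply/attP; exists 0; [rim_lia | rewrite /arm l0 subn0].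
Qed.

(** A two-edge path [c] and a shortest connection [s] from it to a contact off the two edges form a
    tripod. Both arms, from the far end of [s] to either end of [c], are tame, which leaves the
    single configuration of [tripod_core], and there two holes disagree about the parity of an
    arm. *)
Lemma rim_escape h : rim h -> connected_set G C ->
  (forall i, i < N -> exists2 c, c \in C & G c (h i)) -> False.
Proof.
move=> hh con all_att.
(* 0 and 3 are nonadjacent of opposite parity, as [N] is at least 6. *)
have [x0 x0C ax0] := all_att 0 ltac:(rim_lia); have [x3 x3C ax3] := all_att 3 ltac:(rim_lia).
have [r [t [t0 rr [ar0 ar3] _ _]]] :=
  @shortest_path T G C (fun x => G x (h 0)) (fun x => G x (h 3)) x0 x3 con x0C ax0 x3C ax3.
have [p0 [m [i [j [/and5P[pm om m1 iN jN] ij te]]]]] :=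
  @two_edges_exist h r t 0 t.-1 0 3 hh rr t0 ltac:(rim_lia) ltac:(rim_lia) ltac:(rim_lia)
    ltac:(by rewrite /opair /cadj; rim_lia) ar0 ar3.
pose c x := r (p0 + x); have cc : cpath c m by apply: cpath_sub rr pm.
rewrite -/c in te; clear x0 x0C ax0 x3 x3C ax3 ar0 ar3.
(* The index two steps after [i] avoids both edges, because [j] is at odd distance at least 3 from
   [i]. *)
have [e eN ne] : exists2 d, d < N & ~~ (sedge i d || sedge j d).
  have [a aN aE] := rot_surj iN jN; have i0 : rot i 0 = i by rewrite /rot addn0 iN.
  have N0 : 0 < N by rim_lia. have N2 : 2 < N by rim_lia.
  have oa : opair 0 a by rewrite -(opair_rot iN) // i0 aE.
  exists (rot i 2); first exact: rot_lt.
  rewrite -{1}i0 -aE !sedge_rot //; move: oa; rewrite /opair /cadj /sedge; rim_lia.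
(* A shortest path from [D1] to [D2] touches [c] only with its first vertex and the rim off the two
   edges only with its last. *)
pose D1 x := [exists p : 'I_m, (x == c p) || G x (c p)].
pose D2 x := [exists d : 'I_N, ~~ (sedge i d || sedge j d) && G x (h d)].
have D1P x p : p < m -> (x == c p) || G x (c p) -> D1 x.
  by move=> pm' H; apply/existsP; exists (Ordinal pm').
have D2P x d : d < N -> ~~ (sedge i d || sedge j d) -> G x (h d) -> D2 x.
  by move=> dN nd H; apply/existsP; exists (Ordinal dN); rewrite nd.
have D2c p : p < m -> ~~ D2 (c p).
  move=> pm'; apply/existsP => -[d /andP[nd]]; rewrite te // => /orP[] /andP[_ hd].
    by rewrite hd in nd.
  by rewrite hd orbT in nd.
have m0 : 0 < m by rim_lia.
have [y yC ay] := all_att e eN.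
have Dc : D1 (c 0) by apply: (D1P _ 0) => //; rewrite eqxx.
have Dy : D2 y := D2P _ _ eN ne ay.
have [s [l [l0 ss [Ds De] n1 n2]]] := shortest_path con (cc.2 _ m0) Dc yC Dy.
have [d [dN nd ad]] : exists d, [/\ d < N, ~~ (sedge i d || sedge j d) & G (s l.-1) (h d)].
  by case/existsP: De => d /andP[nd ad]; exists d.
have nadj p x : 0 < p < l -> x < m -> ~~ G (s p) (c x).
  by move=> pl xm; apply/negP => a; have := n1 p pl; rewrite (D1P _ x) // a orbT.
have dis p x : p < l -> x < m -> s p <> c x.
  move=> pl xm E; have [p00|p00] := posnP p; last first.
    by have := n1 p; rewrite p00 pl (D1P _ x) ?E ?eqxx // => /(_ isT).
  rewrite p00 in E pl; have [l1|l1] := eqVneq l 1.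
    by move: De; rewrite l1 /= E; apply/negP; apply: D2c.
  have l2 : 0 < 1 < l by rim_lia.
  by have := nadj 1 x l2 xm; rewrite -E ss.1.2.
have at_c : attaches c m s l.
  split=> //; case/existsP: Ds => u /orP[/eqP E|a]; last by exists u.
  by case: (dis 0 u).
have [f1 f1m R1] := arm_path cc ss l0 at_c.
have [f2 f2m R2] := arm_path (cpath_rev cc) ss l0 (attaches_rev at_c).
have f1s : f1 < m.-1 by apply: arm_short hh te R1 _ _ _ iN jN _ dN nd ad.
have f2s : f2 < m.-1.
  have ji : opair j i by rewrite opairC.
  have nd' : ~~ (sedge j d || sedge i d) by rewrite orbC.
  exact: arm_short hh (two_edges_rev te) R2 f2m m1 l0 jN iN ji dN nd' ad.
have [g [j' [d' [hs rj dj sd sE]]]] := normalize hh iN jN dN ij nd.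
have te' : two_edges (h \o g) c m 0 j'.
  by move=> p x pm' xN; have [sN s1 s2] := sE x xN; rewrite /= te // s1 s2.
have Sd : att (h \o g) s l d' by apply/attP; exists l.-1; [rim_lia | rewrite /= sd].
have [j3 d2 S0 S1] := tripod_core rj dj (tame_path hs R1) (tame_path hs R2) Sd
  (fun x xN => arm_att s l te' f1s xN) (fun x xN => arm_att s l (two_edges_rev te') f2s xN).
subst j' d'.
set t1 := l + f1.+1 in R1.
have at01 z p : z < 2 -> p < t1 -> G (arm c s l f1 p) ((h \o g) z) = (p == t1.-1).
  move=> z2 pt; have zN : z < N by rim_lia.
  have Sz : ~~ att (h \o g) s l z by have [->|->] : z = 0 \/ z = 1 by rim_lia.
  rewrite /arm; case: ltnP => pl.
    transitivity false; last by rewrite /t1 in pt *; rim_lia.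
    by apply/negbTE; apply: contra Sz => a; apply/attP; exists (l.-1 - p) => //; rim_lia.
  by rewrite te' // /sedge /t1 in pt *; rim_lia.
have at2 p : p < t1 -> G (arm c s l f1 p) ((h \o g) 2) = (p == 0).
  move=> pt; rewrite /arm; case: ltnP => pl; last first.
    by rewrite te' // /sedge /t1 in pt *; rim_lia.
  rewrite /= sd; have [->|p00] := eqVneq p 0; first by rewrite subn0.
  apply/negbTE/negP => a; have := n2 (l.-1 - p); rewrite (D2P _ d) //; rim_lia.
(* The first arm joins [h 2] to the edge 01: the hole through [v] makes its length odd, the hole
   through the edge 12 makes it even. *)
have ot : odd t1.
  apply: (odd_apex (i := 2) (j := 0) hs R1); rewrite /cadj; try rim_lia.
    exact: at2.
  by move=> p; apply: at01.
suff : ~~ odd (2 + t1) by rim_lia.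
apply: (even_arc (i := 1) hs (cpath_rev R1)); try rim_lia.
move=> [|[|z]] // p _ pt /=; rewrite ?addn0 ?add1n.
  by rewrite at01 //; rim_lia.
by rewrite at2 //; rim_lia.
Qed.

End Attachments.

(** * Vertices with chordal neighbourhoods *)

Section Elimination.
Variables (T : finType) (G : graph T).

Lemma connected_setU1 (C : {set T}) b c :
  connected_set G C -> c \in C -> G b c -> connected_set G (b |: C).
Proof.
move=> con cC bc.
have sub x y : connect (within G C) x y -> connect (within G (b |: C)) x y.
  apply: connect_sub => u w /and3P[uw uC wC]; apply: connect1; apply/and3P.
  by split=> //; apply: setU1r.
have cU : c \in b |: C by apply: setU1r.
have to_c x : x \in b |: C -> connect (within G (b |: C)) x c.
  case/setU1P => [->|xC]; last exact/sub/con.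
  by apply: connect1; apply/and3P; rewrite setU11.
have from_c x : x \in b |: C -> connect (within G (b |: C)) c x.
  case/setU1P => [->|xC]; last exact/sub/con.
  by apply: connect1; apply/and3P; rewrite setU11 adj_sym.
by move=> x y /to_c xc /from_c; apply: connect_trans.
Qed.

(** Serves twice, with nonadjacent pairs and with holes as bad sets. The second hypothesis says that
    the complement graph is connected on a bad set; together with the third, which puts one of its
    vertices into the part [X] anticomplete to [C], it pushes the whole bad set into [X], where the
    recursion excludes it. *)
Lemma elimination_vertex (W0 : {set T}) (bad : {set T} -> Prop) :
    (forall F, bad F -> exists x y, [/\ x \in F, y \in F, x != y & ~~ G x y]) ->
    (forall F (X : {set T}), bad F ->
      (forall x y, x \in F -> y \in F -> x \in X -> y \notin X -> G x y) ->
      (exists2 x, x \in F & x \in X) -> F \subset X) ->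
    (forall (F : {set T}) v (C : {set T}), bad F -> F \subset W0 -> v \in W0 -> C \subset W0 ->
      (forall x, x \in F -> G v x) -> connected_set G C ->
      (forall c, c \in C -> c != v /\ ~~ G v c) ->
      exists2 y, y \in F & forall c, c \in C -> ~~ G y c) ->
  forall W : {set T}, W \subset W0 -> W != set0 ->
  exists2 x, x \in W & forall F : {set T}, bad F -> F \subset W -> ~ forall y, y \in F -> G x y.
Proof.
move=> nclique anticon loc W; elim: {W}_.+1 {-2}W (ltnSn #|W|) => // k IH W leW WW0 W0'.
have [x0 x0W] := set0Pn _ W0'.
(* Minimising [n] maximises the size of [C]. *)
pose P n := exists v (C : {set T}), [/\ v \in W, C \subset W, C != set0, connected_set G C &
  (forall c, c \in C -> c != v /\ ~~ G v c) /\ n = #|T| - #|C|].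
have [clW|] := classic (forall x y, x \in W -> y \in W -> x != y -> G x y).
  exists x0 => // F bF FW _; have [x [y [xF yF xy]]] := nclique F bF.
  by rewrite clW // (subsetP FW).
move=> ncl; have exP : exists n, P n.
  have [x [y [xW yW xy nxy]]] : exists x y, [/\ x \in W, y \in W, x != y & ~~ G x y].
    apply: NNPP => H; apply: ncl => x y xW yW xy; apply/negPn/negP => nxy; apply: H.
    by exists x, y.
  exists (#|T| - #|[set y]|), x, [set y]; split=> //.
  - by rewrite sub1set.
  - by apply/set0Pn; exists y; rewrite set11.
  - by move=> u w /set1P -> /set1P ->; apply: connect0.
  - by split=> // c /set1P ->; rewrite eq_sym.
have [n [v [C [vW CW C0 con [Cv nE]]]] nmin] := nat_min exP.
pose X := [set x in W | (x \notin C) && [forall c in C, ~~ G x c]].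
have XP x c : x \in X -> c \in C -> c != x /\ ~~ G x c.
  rewrite inE => /and3P[_ xC /forall_inP nx] cC; split; last exact: nx.
  by apply: contraNneq xC => <-.
(* Such a [b] has a neighbour in [C]; if it were not adjacent to [x], then [b |: C] with the vertex
   [x] would beat the maximal choice. *)
have XB x b : x \in X -> b \in W -> b \notin X -> b \notin C -> G x b.
  move=> xX bW bX bC; apply/negPn/negP => nxb.
  have [c cC bc] : exists2 c, c \in C & G b c.
    move: bX; rewrite inE bW bC /= negb_forall => /existsP[c].
    by rewrite negb_imply negbK => /andP[]; exists c.
  have xW : x \in W by move: xX; rewrite inE => /andP[].
  have CT : #|C| < #|T|.
    by rewrite -cardsT; apply: proper_card; apply/properP; split; [apply: subsetT|exists b].
  have := nmin (#|T| - #|b |: C|); rewrite cardsU1 bC /= => H.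
  suff : n <= #|T| - (1 + #|C|) by move: CT; rewrite nE; move: #|T| #|C| => s t; clear; lia.
  apply: H; exists x, (b |: C); split=> //.
  - by rewrite subUset sub1set bW.
  - by apply/set0Pn; exists b; rewrite setU11.
  - exact: connected_setU1 cC bc.
  - split; last by rewrite cardsU1 bC.
    move=> c' /setU1P[->|/XP]; last exact.
    by split=> //; apply: contraNneq bX => ->.
have XW : X \subset W by apply/subsetP => x; rewrite inE => /andP[].
have vX : v \in X.
  rewrite inE vW /=; apply/andP; split; last by apply/forall_inP => c /Cv[].
  by apply/negP => /Cv[]; rewrite eqxx.
have [||x xX good] := IH X _ (subset_trans XW WW0); last 1 first.
- exists x; first exact: (subsetP XW).
  move=> F bF FW xF; apply: (good F bF) => //.
  have [y yF yC] : exists2 y, y \in F & forall c, c \in C -> ~~ G y c.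
    apply: (loc F x C) => //; [exact: subset_trans WW0 | | exact: subset_trans WW0 | by move=> c; apply: XP].
    by apply: (subsetP WW0); apply: (subsetP XW).
  have FC z : z \in F -> z \notin C.
    by move=> zF; apply/negP => zC; have [_] := XP x z xX zC; rewrite xF.
  apply: anticon => // [u w uF wF uX wX|]; first by apply: XB => //; [apply: (subsetP FW)|apply: FC].
  exists y => //; rewrite inE (subsetP FW) // FC //=; apply/forall_inP; exact: yC.
- apply: leq_trans (_ : #|W| <= _); last by rewrite -ltnS.
  apply: proper_card; apply/properP; split=> //; have [c cC] := set0Pn _ C0.
  by exists c; [exact: (subsetP CW) | rewrite inE cC andbF].
- by apply/set0Pn; exists v.
Qed.

(** If both members of a nonadjacent pair had neighbours in [C], a shortest path of [C] between such
    neighbours would close up through [v] to a hole inside [W]. *)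
Lemma simplicial_vertex (W : {set T}) :
    (forall c, hole G c -> ~ {subset c <= W}) -> W != set0 ->
  exists2 x, x \in W & forall y z, y \in W -> z \in W -> G x y -> G x z -> y != z -> G y z.
Proof.
move=> nohole W0.
pose bad (F : {set T}) := exists y z, [/\ y != z, ~~ G y z & F = [set y; z]].
have [F [y [z [yz nyz ->]]]||F v C [y [z [yz nyz ->]]] FW vW CW vF con Cv|x xW good] :=
  @elimination_vertex W bad _ _ _ W (subxx _) W0.
- by exists y, z; rewrite set21 set22.
- move=> F X [y [z [yz nyz ->]]] XG [u].
  have zy : ~~ G z y by rewrite adj_sym.
  have yX : (y \in X) = (z \in X).
    apply/idP/idP => aX; apply/negPn/negP => bX.
      by case/negP: nyz; apply: XG; rewrite ?set21 ?set22.
    by case/negP: zy; apply: XG; rewrite ?set21 ?set22.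
  by rewrite subUset !sub1set yX andbb => /set2P[]->; rewrite ?yX.
- apply: NNPP => none.
  have nb u : u \in [set y; z] -> exists2 c, c \in C & G u c.
    move=> uF; apply: NNPP => H; apply: none; exists u => // c cC.
    by apply/negP => uc; apply: H; exists c.
  have [a aC ya] := nb y (set21 _ _); have [b bC zb] := nb z (set22 _ _).
  have vy : G v y by apply: vF; rewrite set21.
  have vz : G v z by apply: vF; rewrite set22.
  have zy : ~~ G z y by rewrite adj_sym.
  have [r [t [t0 [ir rC] [r0 rt] n1 n2]]] := shortest_path con aC ya bC zb.
  pose q := nth v [:: y; v; z].
  have iq : ipath G q 3.
    split=> i j; case: i => [|[|[|i]]] //; case: j => [|[|[|j]]] // _ _; rewrite /q /=;
      rewrite ?adj_irr ?vy ?vz ?[G _ v]adj_sym ?vy ?vz ?(negbTE nyz) ?(negbTE zy) // => E;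
      by move: vy vz yz; rewrite ?E ?adj_irr ?eqxx // -?E ?adj_irr.
  have [] := @cyc_hole _ G _ (3 + t) _ (cyc_glue _ t0 _ iq ir _ _) => //.
  + move=> i p; case: i => [|[|[|i]]] // _ pt; rewrite /q /=.
    * by move=> E; have [_] := Cv _ (rC _ pt); rewrite -E vy.
    * by move=> E; have [] := Cv _ (rC _ pt); rewrite -E eqxx.
    * by move=> E; have [_] := Cv _ (rC _ pt); rewrite -E vz.
  + move=> i p; case: i => [|[|[|i]]] // _ pt; rewrite /q /=.
    * rewrite orbF; have [->//|p0] := eqVneq p 0.
      by apply/negbTE; apply: n1; rewrite lt0n p0.
    * by have [_ /negbTE] := Cv _ (rC _ pt).
    * have [->//|p0] := eqVneq p t.-1.
      by apply/negbTE; apply: n2; nat_lia.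
  move=> c [hc _ cE]; case: (nohole c hc) => u /cE[i _ ->].
  have FW' := subsetP FW; case: ifP => i3; last by apply: (subsetP CW); apply: rC; nat_lia.
  case: i i3 => [|[|[|i]]] //= _; rewrite /q /=; [apply: FW'; exact: set21 | apply: FW'; exact: set22].
- exists x => // y z yW zW xy xz yz; apply/negPn/negP => nyz.
  apply: (good [set y; z]); first by exists y, z.
    by rewrite subUset !sub1set yW.
  by move=> u /set2P[] ->.
Qed.

Lemma even_cyc_of_holes : (forall c, hole G c -> size c <> 4 /\ ~~ odd (size c)) ->
  forall h N, 4 <= N -> cyc G h N -> N <> 4 /\ ~~ odd N.
Proof. by move=> H h N N4 /(cyc_hole N4)[c [/H + <- _]]. Qed.

Lemma hole_free_vertex (W : {set T}) :
    (forall c, hole G c -> size c <> 4 /\ ~~ odd (size c)) -> W != set0 ->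
  exists2 x, x \in W & forall c, hole G c -> ~ {subset c <= [set y in W | G x y]}.
Proof.
move=> even W0.
pose bad (F : {set T}) := exists2 c, hole G c & F = [set x in c].
have size6 c : hole G c -> 6 <= size c.
  by move=> hc; have [n4 ev] := even c hc; have /andP[c4 _] := hc; nat_lia.
have idx (c : seq T) x0 x : x \in c -> exists2 i, i < size c & x = nth x0 c i.
  by move=> xc; exists (index x c); rewrite ?index_mem ?nth_index.
have [|||x xW good] := @elimination_vertex setT bad _ _ _ W (subsetT _) W0.
- move=> F [c hc ->]; have c6 := size6 c hc.
  have [x0 _] : exists x0, x0 \in c by case: c c6 {hc} => // x0 c _; exists x0; rewrite mem_head.
  have [inj adj] := hole_cyc x0 hc.
  have [i0 i2] : 0 < size c /\ 2 < size c by split; apply: leq_trans c6.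
  exists (nth x0 c 0), (nth x0 c 2); rewrite !inE !mem_nth // adj //.
  split=> //; last by rewrite /cadj; move: (size c) c6 => N; nat_lia.
  by apply/eqP => /(inj _ _ i0 i2).
- move=> F X [c hc ->] XG [u]; rewrite inE => uc uX; have c6 := size6 c hc.
  have [inj adj] := hole_cyc u hc; pose h := nth u c; set N := size c in c6 inj adj.
  have G_cadj i j : i < N -> j < N -> h i \in X -> h j \notin X -> cadj N i j.
    by move=> iN jN iX jX; rewrite -adj //; apply: XG; rewrite ?inE ?mem_nth.
  have [i iN uE] := idx c u u uc.
  have iX : h i \in X by rewrite /h -uE.
  apply/subsetP => y; rewrite inE => yc; have [j jN ->] := idx c u y yc.
  apply/negPn/negP => jX; have ij := G_cadj i j iN jN iX jX.
  (* A common non-neighbour on the hole, available for lengths at least 6; wherever it lies, it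
     breaks the completeness between [X] and its complement. *)
  have [e [eN ei ej]] : exists e, [/\ e < N, ~~ cadj N i e & ~~ cadj N e j].
    have [ji|ji] := boolP ((j == i.+1) || ((j == 0) && (i.+1 == N))).
      exists (if i + 3 < N then i + 3 else i + 3 - N).
      by case: (ltnP (i + 3) N) => ?; move: ji; rewrite /cadj; split; nat_lia.
    exists (if i + 2 < N then i + 2 else i + 2 - N).
    by case: (ltnP (i + 2) N) => ?; move: ji ij; rewrite /cadj; split; nat_lia.
  have [eX|eX] := boolP (h e \in X); first by rewrite G_cadj in ej.
  by rewrite G_cadj in ei.
- move=> F v C [c hc ->] _ _ _ vF con Cv; apply: NNPP => none.
  have c6 := size6 c hc; have [_ ev] := even c hc.
  apply: (@rim_escape T G (even_cyc_of_holes even) v C (size c) Cv c6 ev (nth v c)) => //.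
    by split=> [|i ic]; [apply: hole_cyc | apply: vF; rewrite inE mem_nth].
  move=> i ic; apply: NNPP => H; apply: none; exists (nth v c i).
    by rewrite inE mem_nth.
  by move=> a aC; apply/negP => ia; apply: H; exists a; rewrite // adj_sym.
- exists x => // c hc sub; apply: (good [set x in c]); first by exists c.
    by apply/subsetP => y; rewrite inE => /sub; rewrite inE => /andP[].
  by move=> y; rewrite inE => /sub; rewrite inE => /andP[].
Qed.

(** A hole contains no triangle, so perfection gives it a colouring with two colours. These
    alternate along the hole, and an odd length makes the last vertex agree with the first. *)
Lemma perfect_odd_hole (c : seq T) : perfect G -> hole G c -> ~~ odd (size c).
Proof.
move=> perf hc; apply/negP => oc.
have c4 : 4 <= size c by case/andP: hc.
have [x0 _] : exists x0, x0 \in c by case: c c4 {hc oc} => // x0 c _; exists x0; rewrite mem_head.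
have [inj adj] := hole_cyc x0 hc; set N := size c in oc c4 inj adj.
pose W := [set x in c]; have := perf W.
have cW i : i < N -> nth x0 c i \in W by move=> iN; rewrite inE mem_nth.
have om2 : clique_number (induced G W) <= 2.
  apply/bigmax_leqP => A clA; rewrite leqNgt; apply/negP => /card_gt2P[x [y [z [[xA yA zA] [xy yz zx]]]]].
  have idx (u : {x | x \in W}) : exists2 i, i < N & val u = nth x0 c i.
    have := valP u; rewrite inE => uc.
    by exists (index (val u) c); rewrite ?index_mem ?nth_index.
  have ad u w : u \in A -> w \in A -> u != w -> G (val u) (val w).
    by move=> uA wA uw; move/forall_inP: clA => /(_ u uA)/forall_inP/(_ w wA)/implyP/(_ uw).
  have [i iN xi] := idx x; have [j jN yj] := idx y; have [l lN zl] := idx z.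
  have := ad _ _ xA yA xy; have := ad _ _ yA zA yz; have := ad _ _ zA xA zx.
  rewrite xi yj zl !adj // /cadj; nat_lia.
rewrite /chromatic_number; case: ex_minnP => m /existsP[f /forallP fP] _ mE.
move: om2; rewrite -mE => m2.
(* The colour read along the hole; the default 0 is not reached for [i < N]. *)
pose g i := if insub (nth x0 c i) is Some u then nat_of_ord (f u) else 0.
have gE i (iN : i < N) : g i = f (Sub (nth x0 c i) (cW i iN)).
  by rewrite /g (insubT (fun x => x \in W) (cW i iN)).
have g2 i : i < N -> g i < 2 by move=> iN; rewrite gE; apply: leq_trans m2; apply: ltn_ord.
have gne i j : i < N -> j < N -> cadj N i j -> g i != g j.
  move=> iN jN ij; rewrite !gE; pose v l (lN : l < N) : {x | x \in W} := Sub (nth x0 c l) (cW l lN).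
  have /forallP fPi := fP (v i iN); have /implyP := fPi (v j jN); apply.
  by rewrite /= /induced_adj /= adj.
have alt i : i < N -> odd (g i + g 0) = odd i.
  elim: i => [|i IH] iN; first by nat_lia.
  have := IH (ltnW iN); have := gne i i.+1; have := g2 i; have := g2 i.+1; have := g2 0.
  rewrite /cadj; nat_lia.
have := alt N.-1; have := gne 0 N.-1; have := g2 N.-1; have := g2 0; rewrite /cadj; nat_lia.
Qed.

End Elimination.

(** * Truncated graded resolutions *)

Section Graded.
Local Open Scope ring_scope.
Variables (k : fieldType) (n : nat).
Local Notation S := {mpoly k[n]}.

(* f is homogeneous of degree d - e; in particular f = 0 if d < e. *)
Definition hom (e d : nat) (f : S) := forall x, f@_x != 0 -> (mdeg x + e)%N = d.

(** The component of degree [m] of an element of [S(-e)]. *)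
Definition hcomp (e m : nat) (f : S) : S :=
  \sum_(x <- msupp f | (mdeg x + e)%N == m) f@_x *: 'X_[x].

Lemma hcompE e m f x :
  (hcomp e m f)@_x = if (mdeg x + e)%N == m then f@_x else 0.
Proof.
rewrite /hcomp raddf_sum /=.
under eq_bigr => y _ do rewrite mcoeffZ mcoeffX.
have [fx|fx] := boolP (x \in msupp f); last first.
  rewrite (memN_msupp_eq0 fx) if_same big_seq_cond big1 // => y /andP[yf _].
  by case: eqP => [yx|]; rewrite ?mulr0 // -yx yf in fx *.
rewrite big_mkcond (bigD1_seq x) ?msupp_uniq //= eqxx mulr1 big1 ?addr0 //.
by move=> y /negbTE ->; rewrite mulr0 if_same.
Qed.

Lemma hcomp_add e m f g : hcomp e m (f + g) = hcomp e m f + hcomp e m g.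
Proof.
by apply/mpolyP => x; rewrite mcoeffD !hcompE mcoeffD; case: ifP; rewrite ?addr0.
Qed.

Lemma hcomp0 e m : hcomp e m 0 = 0.
Proof. by apply/mpolyP => x; rewrite hcompE mcoeff0 if_same. Qed.

Lemma hcomp_sum (I : Type) (r : seq I) (P : pred I) e m (F : I -> S) :
  hcomp e m (\sum_(i <- r | P i) F i) = \sum_(i <- r | P i) hcomp e m (F i).
Proof. exact: (big_morph _ (hcomp_add e m) (hcomp0 e m)). Qed.

Lemma hcompM e d m f g : hom e d g -> hcomp e m (f * g) = hcomp d m f * g.
Proof.
move=> hg; apply/mpolyP => x; rewrite hcompE !mcoeffM.
rewrite [LHS](_ : _ = \sum_(j : 'X_{1..n < (mdeg x).+1, (mdeg x).+1} | x == (j.1 + j.2)%MM)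
    if (mdeg x + e)%N == m then f@_j.1 * g@_j.2 else 0); last first.
  by case: ifP => _ //; rewrite big1.
apply: eq_bigr => -[y z] /= /eqP xyz; rewrite hcompE.
have [->|/hg zd] := eqVneq g@_z 0; first by rewrite !mulr0 if_same.
have -> : ((mdeg x + e)%N == m) = ((mdeg y + d)%N == m).
  by rewrite -zd addnA -mdegD -xyz.
by case: ifP; rewrite ?mul0r.
Qed.

Lemma hom_hcomp e m f : hom e m (hcomp e m f).
Proof. by move=> x; rewrite hcompE; case: ifP => [/eqP|]; rewrite ?eqxx. Qed.

Lemma hcomp_id e m f : hom e m f -> hcomp e m f = f.
Proof.
move=> hf; apply/mpolyP => x; rewrite hcompE; case: eqP => // ne.
by apply/esym/eqP; apply: contra_notT ne => /hf.
Qed.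

Lemma hom0 e d : hom e d 0.
Proof. by move=> x; rewrite mcoeff0 eqxx. Qed.

Lemma hom_add e d f g : hom e d f -> hom e d g -> hom e d (f + g).
Proof. by move=> hf hg; rewrite -(hcomp_id hf) -(hcomp_id hg) -hcomp_add; apply: hom_hcomp. Qed.

Lemma hom_opp e d f : hom e d f -> hom e d (- f).
Proof. by move=> hf x; rewrite mcoeffN oppr_eq0; apply: hf. Qed.

Lemma hom_sum (I : Type) (r : seq I) (P : pred I) e d (F : I -> S) :
  (forall i, P i -> hom e d (F i)) -> hom e d (\sum_(i <- r | P i) F i).
Proof. by move=> h; apply: big_ind => //; [apply: hom0 | move=> *; apply: hom_add]. Qed.

Lemma hom_mul e d m f g : hom d m f -> hom e d g -> hom e m (f * g).
Proof. by move=> hf hg; rewrite -(hcomp_id hf) -(hcompM _ _ hg); apply: hom_hcomp. Qed.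

Lemma hom1 d : hom d d 1.
Proof. by move=> x; rewrite mcoeff1; have [->|_] := eqVneq x 0%MM; rewrite ?mdeg0 ?eqxx. Qed.

Lemma homX d (i : 'I_n) : hom d d.+1 'X_i.
Proof. by move=> x; rewrite mcoeffX; have [<-|_] := eqVneq U_(i)%MM x; rewrite ?mdeg1 ?eqxx. Qed.

Definition gmx p q (d : 'I_p -> nat) (e : 'I_q -> nat) (A : 'M[S]_(p, q)) :=
  forall a b, hom (e b) (d a) (A a b).

Definition vcomp q (e : 'I_q -> nat) m (u : 'rV[S]_q) : 'rV[S]_q :=
  \row_j hcomp (e j) m (u 0 j).

Lemma vcompM p q d e (A : 'M_(p, q)) m c :
  gmx d e A -> vcomp e m (c *m A) = vcomp d m c *m A.
Proof.
move=> gA; apply/rowP => j; rewrite !mxE hcomp_sum.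
by apply: eq_bigr => a _; rewrite !mxE (hcompM _ _ (gA a j)).
Qed.

Lemma vcomp_id q (e : 'I_q -> nat) m (u : 'rV_q) :
  (forall j, hom (e j) m (u 0 j)) -> vcomp e m u = u.
Proof. by move=> h; apply/rowP => j; rewrite mxE hcomp_id. Qed.

Lemma hom_vcomp q (e : 'I_q -> nat) m (u : 'rV_q) j : hom (e j) m (vcomp e m u 0 j).
Proof. by rewrite mxE; apply: hom_hcomp. Qed.

Lemma vcomp0 q (e : 'I_q -> nat) m : vcomp e m 0 = 0.
Proof. by apply/rowP => j; rewrite !mxE hcomp0. Qed.

Lemma gmx_mul p q s (d : 'I_p -> nat) (e : 'I_q -> nat) (h : 'I_s -> nat)
    (A : 'M_(p, q)) (B : 'M_(q, s)) :
  gmx d e A -> gmx e h B -> gmx d h (A *m B).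
Proof. by move=> gA gB a b; rewrite mxE; apply: hom_sum => c _; apply: hom_mul (gA _ _) (gB _ _). Qed.

Lemma gmx1 p (d : 'I_p -> nat) : gmx d d 1%:M.
Proof. by move=> a b; rewrite mxE; case: eqP => [->|_]; [apply: hom1 | apply: hom0]. Qed.

Lemma gmx0 p q (d : 'I_p -> nat) (e : 'I_q -> nat) : gmx d e 0.
Proof. by move=> a b; rewrite mxE; apply: hom0. Qed.

Lemma gmx_opp p q (d : 'I_p -> nat) (e : 'I_q -> nat) A : gmx d e A -> gmx d e (- A).
Proof. by move=> gA a b; rewrite mxE; apply: hom_opp. Qed.

Definition jd p q (d : 'I_p -> nat) (e : 'I_q -> nat) (i : 'I_(p + q)) :=
  match split i with inl a => d a | inr b => e b end.

Lemma jdl p q d e (i : 'I_p) : @jd p q d e (lshift q i) = d i.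
Proof. by rewrite /jd; have := unsplitK (inl i : 'I_p + 'I_q) => /= ->. Qed.

Lemma jdr p q d e (i : 'I_q) : @jd p q d e (rshift p i) = e i.
Proof. by rewrite /jd; have := unsplitK (inr i : 'I_p + 'I_q) => /= ->. Qed.

Lemma gmx_col p1 p2 q (d1 : 'I_p1 -> nat) (d2 : 'I_p2 -> nat) (e : 'I_q -> nat) A B :
  gmx d1 e A -> gmx d2 e B -> gmx (jd d1 d2) e (col_mx A B).
Proof.
move=> gA gB a b; case: (split_ordP a) => i ->; rewrite ?col_mxEu ?col_mxEd ?jdl ?jdr.
  exact: gA.
exact: gB.
Qed.

Lemma gmx_row p q1 q2 (d : 'I_p -> nat) (e1 : 'I_q1 -> nat) (e2 : 'I_q2 -> nat) A B :
  gmx d e1 A -> gmx d e2 B -> gmx d (jd e1 e2) (row_mx A B).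
Proof.
move=> gA gB a b; case: (split_ordP b) => i ->; rewrite ?row_mxEl ?row_mxEr ?jdl ?jdr.
  exact: gA.
exact: gB.
Qed.

Record gsub q (e : 'I_q -> nat) (M : 'rV[S]_q -> Prop) : Prop := Gsub {
  gsub0 : M 0;
  gsubD : forall u w, M u -> M w -> M (u + w);
  gsubZ : forall c u, M u -> M (c *: u);
  gsubH : forall m u, M u -> M (vcomp e m u)
}.

Lemma gsubB q e M : @gsub q e M -> forall u w, M u -> M w -> M (u - w).
Proof. by move=> gM u w Mu Mw; rewrite -scaleN1r; apply: gsubD gM _ _ Mu (gsubZ gM _ Mw). Qed.

Lemma gsub_ker p q d e (A : 'M_(p, q)) : gmx d e A -> gsub d (fun c => c *m A = 0).
Proof.
move=> gA; split=> [|u w Au Aw|c u Au|m u Au]; first by rewrite mul0mx.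
- by rewrite mulmxDl Au Aw addr0.
- by rewrite -scalemxAl Au scaler0.
- by rewrite -(vcompM _ _ gA) Au vcomp0.
Qed.

Lemma gsub_mul p q d e (A : 'M_(p, q)) M :
  gmx d e A -> gsub e M -> gsub d (fun c => M (c *m A)).
Proof.
move=> gA gM; split=> [|u w Au Aw|c u Au|m u Au]; first by rewrite mul0mx; apply: gsub0 gM.
- by rewrite mulmxDl; apply: gsubD gM _ _ Au Aw.
- by rewrite -scalemxAl; apply: gsubZ gM _ _ Au.
- by rewrite -(vcompM _ _ gA); apply: gsubH gM _ _ Au.
Qed.

Lemma gsub_rows p q e M (c : 'rV_p) (A : 'M_(p, q)) :
  @gsub q e M -> (forall a, M (row a A)) -> M (c *m A).
Proof.
move=> gM MA; rewrite mulmx_sum_row; apply: big_ind => [|u w|a _].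
- exact: gsub0 gM.
- exact: gsubD gM u w.
- exact: gsubZ gM _ _ (MA a).
Qed.

(** Since [B] preserves degrees, an arbitrary lift of row [a] may be replaced by its component of
    degree [d a]. *)
Lemma graded_lift p q s (d : 'I_p -> nat) (e : 'I_q -> nat) (h : 'I_s -> nat) M
    (A : 'M_(p, s)) (B : 'M_(q, s)) :
    gsub e M -> gmx d h A -> gmx e h B ->
    (forall a, exists w, M w /\ w *m B = row a A) ->
  exists T : 'M_(p, q), [/\ gmx d e T, forall a, M (row a T) & T *m B = A].
Proof.
move=> gM gA gB lft.
pose T := \matrix_a vcomp e (d a) (proj1_sig (constructive_indefinite_description _ (lft a))).
exists T; split=> [a b|a|].
- by rewrite mxE; apply: hom_vcomp.
- by rewrite rowK; case: constructive_indefinite_description => w [Mw _] /=; apply: gsubH gM _ _ Mw.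
- apply/row_matrixP => a; rewrite row_mul rowK.
  case: constructive_indefinite_description => w [_ wB] /=.
  rewrite -(vcompM _ _ gB) wB; apply: vcomp_id => j; rewrite mxE; exact: gA.
Qed.

Lemma row_mulE p q s (A : 'M[S]_(p, q)) (B : 'M[S]_(q, s)) a : row a A *m B = row a (A *m B).
Proof. by rewrite row_mul. Qed.

Definition spans p q (A : 'M[S]_(p, q)) (M : 'rV[S]_q -> Prop) :=
  forall u, M u <-> exists c, u = c *m A.

(** The bound grows by one with each syzygy module, so generators of the i-th step have degree at
    most [r + i], as in the definition of Castelnuovo-Mumford regularity. *)
Fixpoint regular N q (e : 'I_q -> nat) (M : 'rV[S]_q -> Prop) (r : nat) : Prop :=
  if N is N'.+1 then
    exists p (d : 'I_p -> nat) (A : 'M_(p, q)),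
      [/\ gmx d e A, forall a, (d a <= r)%N, spans A M
        & regular N' d (fun c => c *m A = 0) r.+1]
  else True.

Lemma spans_row p q (A : 'M[S]_(p, q)) M a : spans A M -> M (row a A).
Proof. by move=> sA; apply/sA; exists (delta_mx 0 a); rewrite rowE. Qed.

Lemma spans_gsub p q d e (A : 'M[S]_(p, q)) M : gmx d e A -> spans A M -> gsub e M.
Proof.
move=> gA sA; split.
- by apply/sA; exists 0; rewrite mul0mx.
- by move=> u w /sA[c ->] /sA[c' ->]; apply/sA; exists (c + c'); rewrite mulmxDl.
- by move=> x u /sA[c ->]; apply/sA; exists (x *: c); rewrite scalemxAl.
- by move=> m u /sA[c ->]; apply/sA; exists (vcomp d m c); rewrite (vcompM _ _ gA).
Qed.

Lemma regular_ext N q e M M' r :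
  (forall u, M u <-> M' u) -> @regular N q e M r -> regular N e M' r.
Proof.
case: N => // N MM' [p [d [A [gA dr sA rA]]]]; exists p, d, A; split=> // u.
by rewrite -MM'; apply: sA.
Qed.

Lemma regular_le N N' q e M r r' :
  (N' <= N)%N -> (r <= r')%N -> @regular N q e M r -> regular N' e M r'.
Proof.
elim: N N' q e M r r' => [|N IH] [|N'] q e M r r' //= leN ler [p [d [A [gA dr sA rA]]]].
exists p, d, A; split=> // [a|]; first exact: leq_trans (dr a) ler.
exact: IH rA.
Qed.

Lemma regular_shift N q e M r :
  @regular N q e M r -> regular N (fun j => (e j).+1) M r.+1.
Proof.
elim: N q e M r => //= N IH q e M r [p [d [A [gA dr sA rA]]]].
exists p, (fun a => (d a).+1), A; split=> //; last exact: IH.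
by move=> a b x /gA; lia.
Qed.

Lemma regular_zero N q e M r : (forall u, M u <-> u = 0) -> @regular N q e M r.
Proof.
elim: N q e M r => //= N IH q e M r M0.
exists 0%N, (fun=> 0%N), 0; split; [by case | by case | move=> u | ].
  rewrite M0; split=> [->|[c ->]]; first by exists 0; rewrite mul0mx.
  by rewrite mulmx0.
by apply: IH => u; rewrite mulmx0 thinmx0.
Qed.

Lemma regular_full N q (e : 'I_q -> nat) r :
  (forall j, (e j <= r)%N) -> regular N e (fun=> True) r.
Proof.
case: N => //= N er; exists q, e, 1%:M; split=> //; first exact: gmx1.
  by move=> u; split=> // _; exists u; rewrite mulmx1.
by apply: regular_zero => u; rewrite mulmx1.
Qed.

Lemma regular_image N q s (e : 'I_q -> nat) (h : 'I_s -> nat) (F : 'M_(q, s)) M r :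
    gmx e h F -> (forall u, M u -> u *m F = 0 -> u = 0) ->
    regular N e M r ->
  regular N h (fun w => exists2 u, M u & w = u *m F) r.
Proof.
case: N => //= N gF iF [p [d [A [gA dr sA rA]]]].
exists p, d, (A *m F); split=> //; first exact: gmx_mul gA gF.
  move=> w; split=> [[u /sA[c ->] ->]|[c ->]]; first by exists c; rewrite mulmxA.
  by exists (c *m A); rewrite ?mulmxA //; apply/sA; exists c.
apply: regular_ext rA => c; rewrite mulmxA; split=> [->|cAF]; first by rewrite mul0mx.
by apply: iF => //; apply/sA; exists c.
Qed.

(** The horseshoe lemma: generators of [A] and lifts of generators of [C] generate [B], and the
    three syzygy modules form an extension again. *)
Lemma regular_extension N qA qB qC (eA : 'I_qA -> nat) (eB : 'I_qB -> nat)
    (eC : 'I_qC -> nat) A B C (F : 'M_(qA, qB)) (G : 'M_(qB, qC)) r :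
    gmx eA eB F -> gmx eB eC G -> gsub eB B ->
    (forall u, A u -> B (u *m F)) -> (forall w, B w -> C (w *m G)) ->
    (forall z, C z -> exists w, B w /\ w *m G = z) ->
    (forall u, A u -> u *m F *m G = 0) ->
    (forall w, B w -> w *m G = 0 -> exists u, A u /\ w = u *m F) ->
    (forall u, A u -> u *m F = 0 -> u = 0) ->
  regular N eA A r -> regular N eC C r -> regular N eB B r.
Proof.
elim: N qA qB qC eA eB eC A B C F G r => //= N IH qA qB qC eA eB eC A B C F G r
  gF gG gB AB BC CB FG ex inj [p [d [P [gP dr sP rP]]]] [p' [d' [P' [gP' dr' sP' rP']]]].
have [T [gT BT TG]] : exists T : 'M_(p', qB), [/\ gmx d' eB T, forall a, B (row a T) & T *m G = P'].
  by apply: graded_lift gB gP' gG _ => a; apply: CB; apply: spans_row.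
have BcT c : B (c *m T) by apply: gsub_rows gB BT.
exists (p + p')%N, (jd d d'), (col_mx (P *m F) T).
have gPF := gmx_mul gP gF.
split.
- exact: gmx_col.
- by move=> a; case: (split_ordP a) => i ->; rewrite ?jdl ?jdr.
- move=> w; split=> [Bw|[c ->]].
    have /sP'[c cE] := BC _ Bw.
    have [||u [/sP[a ->] uE]] := ex (w - c *m T).
    + exact: gsubB gB _ _ Bw (BcT c).
    + by rewrite mulmxBl -mulmxA TG cE subrr.
    exists (row_mx a c); rewrite mul_row_col mulmxA -uE subrK //.
  rewrite -[c]hsubmxK mul_row_col; apply: gsubD gB _ _ _ (BcT _).
  by rewrite mulmxA; apply: AB; apply/sP; exists (lsubmx c).
- apply: (IH p (p + p')%N p' d (jd d d') d' (fun c => c *m P = 0) _ (fun c => c *m P' = 0)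
    (row_mx 1%:M 0) (col_mx 0 1%:M)) => //.
  + by apply: gmx_row; [apply: gmx1 | apply: gmx0].
  + by apply: gmx_col; [apply: gmx0 | apply: gmx1].
  + by apply: gsub_ker; apply: gmx_col.
  + by move=> u uP; rewrite mul_mx_row mulmx1 mulmx0 mul_row_col mul0mx addr0 mulmxA uP mul0mx.
  + move=> w wE; rewrite -[w]hsubmxK mul_row_col mulmx0 add0r mulmx1.
    move: wE; rewrite -{1}[w]hsubmxK mul_row_col => /(congr1 (mulmxr G)) /=.
    rewrite mulmxDl mul0mx mulmxA FG ?add0r -?mulmxA ?TG //.
    by apply/sP; exists (lsubmx w).
  + move=> c cP'; have [||u [/sP[a ->] uE]] := ex (c *m T) => //.
      by rewrite -mulmxA TG.
    (* [c *m T] need not vanish, but it comes from [A], and [- a] cancels it. *)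
    exists (row_mx (- a) c); rewrite !mul_row_col mulmx0 mulmx1 add0r; split=> //.
    by rewrite uE mulNmx mulmxA addNr.
  + by move=> u _; rewrite mul_mx_row mulmx0 mulmx1 mul_row_col mulmx0 mul0mx addr0.
  + move=> w wE w0; have w2 : rsubmx w = 0.
      by move: w0; rewrite -{1}[w]hsubmxK mul_row_col mulmx0 add0r mulmx1.
    exists (lsubmx w); split; last by rewrite -{1}[w]hsubmxK w2 mul_mx_row mulmx1 mulmx0.
    apply: inj; first by apply/sP; exists (lsubmx w).
    by move: wE; rewrite -{1}[w]hsubmxK mul_row_col w2 mul0mx addr0 mulmxA.
  + move=> u _; rewrite mul_mx_row mulmx1 => /(congr1 lsubmx).
    by rewrite row_mxKl linear0.
Qed.

(** If [P] covers [B], then [P *m G] covers [C], and its kernel is an extension of the kernel of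
    [B -> C] by the syzygies of [P], both with bound [r.+1]. *)
Lemma regular_quotient N q s (e : 'I_q -> nat) (h : 'I_s -> nat) (G : 'M_(q, s)) B C r :
    gmx e h G -> gsub e B ->
    (forall z, C z <-> exists2 w, B w & z = w *m G) ->
    regular N e B r -> regular N e (fun w => B w /\ w *m G = 0) r.+1 ->
  regular N h C r.
Proof.
case: N => //= N gG gB CE [p [d [P [gP dr sP rP]]]] rA.
have gPG := gmx_mul gP gG.
exists p, d, (P *m G); split=> //.
  move=> z; rewrite CE; split=> [[w /sP[c ->] ->]|[c ->]]; first by exists c; rewrite mulmxA.
  by exists (c *m P); rewrite ?mulmxA //; apply/sP; exists c.
have {}rA : regular N e (fun w => B w /\ w *m G = 0) r.+1.
  exact: (@regular_le N.+1 N q e _ r.+1 r.+1).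
apply: (@regular_extension N p p q d d e (fun c => c *m P = 0) _ _ 1%:M P) rP rA => //.
- exact: gmx1.
- exact: gsub_ker.
- by move=> u uP; rewrite mulmx1 mulmxA uP mul0mx.
- by move=> c cPG; split; [apply/sP; exists c | rewrite -mulmxA].
- by move=> z [/sP[c ->] cPG]; exists c; rewrite mulmxA.
- by move=> u uP; rewrite mulmx1.
- by move=> w _ wP; exists w; rewrite mulmx1.
- by move=> u _; rewrite mulmx1.
Qed.

(* Schanuel: the kernel of [D] is the pullback of the two covers. *)
Lemma regular_syzygy N p q (d : 'I_p -> nat) (e : 'I_q -> nat) (A : 'M_(p, q)) M r :
    gmx d e A -> (forall a, (d a <= r)%N) -> spans A M ->
    regular N.+1 e M r ->
  regular N d (fun c => c *m A = 0) r.+1.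
Proof.
move=> gA dr sA [p' [d' [A' [gA' dr' sA' rA']]]].
have gD := gmx_col gA (gmx_opp gA').
pose D := col_mx A (- A').
have DE c : (c *m D = 0) <-> (lsubmx c *m A = rsubmx c *m A').
  rewrite -{1}[c]hsubmxK mul_row_col mulmxN; split=> [/eqP|->]; last by rewrite subrr.
  by rewrite subr_eq0 => /eqP.
have rX : regular N (jd d d') (fun c => c *m D = 0) r.+1.
  apply: (@regular_extension N p' (p + p')%N p d' (jd d d') d (fun c => c *m A' = 0) _ (fun=> True)
    (row_mx 0 1%:M) (col_mx 1%:M 0)) => //.
  - by apply: gmx_row; [apply: gmx0 | apply: gmx1].
  - by apply: gmx_col; [apply: gmx1 | apply: gmx0].
  - exact: gsub_ker.
  - by move=> u uA'; apply/DE; rewrite mul_mx_row row_mxKl row_mxKr mulmx0 mulmx1 mul0mx uA'.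
  - move=> z _; have /sA'[c zc] : M (z *m A) by apply/sA; exists z.
    exists (row_mx z c); split; first by apply/DE; rewrite row_mxKl row_mxKr.
    by rewrite mul_row_col mulmx1 mulmx0 addr0.
  - by move=> u _; rewrite mul_mx_row mulmx0 mulmx1 mul_row_col mul0mx mulmx0 addr0.
  - move=> w /DE wE; rewrite -{1}[w]hsubmxK mul_row_col mulmx1 mulmx0 addr0 => w0.
    exists (rsubmx w); split; first by rewrite -wE w0 mul0mx.
    by rewrite -{1}[w]hsubmxK w0 mul_mx_row mulmx0 mulmx1.
  - move=> u _; rewrite mul_mx_row mulmx1 => /(congr1 rsubmx).
    by rewrite row_mxKr linear0.
  - by apply: regular_full => a; apply: leq_trans (dr a) _.
(* The graph of [T] is a free submodule of the pullback, and the quotient by it is the kernel of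
   [A]. *)
have [T [gT _ TA]] : exists T : 'M_(p', p), [/\ gmx d' d T, forall a : 'I_p', True & T *m A = A'].
  apply: (@graded_lift _ _ _ d' d e (fun=> True)) => // a.
  by have /sA[c cE] : M (row a A') by [apply: spans_row]; exists c; rewrite -cE.
apply: (@regular_quotient N (p + p')%N p (jd d d') d (col_mx 1%:M (- T))
  (fun c : 'rV_(p + p') => c *m D = 0) _ r.+1) => //.
- by apply: gmx_col; [apply: gmx1 | apply: gmx_opp].
- exact: gsub_ker.
- move=> z; split=> [zA|[w /DE wE ->]].
    exists (row_mx z 0); last by rewrite mul_row_col mulmx1 mul0mx addr0.
    by apply/DE; rewrite row_mxKl row_mxKr mul0mx.
  rewrite -{1}[w]hsubmxK mul_row_col mulmx1 mulmxN mulmxBl -mulmxA TA wE subrr //.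
apply: (@regular_ext _ _ _ (fun w => exists2 u, True & w = u *m row_mx T 1%:M)).
  move=> w; split=> [[u _ ->]|[/DE wE]].
    split; first by apply/DE; rewrite mul_mx_row row_mxKl row_mxKr mulmx1 -mulmxA TA.
    by rewrite mul_mx_row mul_row_col !mulmx1 mulmxN subrr.
  rewrite -{1}[w]hsubmxK mul_row_col mulmx1 mulmxN => /eqP; rewrite subr_eq0 => /eqP wT.
  by exists (rsubmx w); rewrite // mul_mx_row -wT mulmx1 hsubmxK.
apply: (@regular_image _ _ _ d').
- by apply: gmx_row => //; apply: gmx1.
- by move=> u _; rewrite mul_mx_row mulmx1 => /(congr1 rsubmx); rewrite row_mxKr linear0.
- by apply: regular_full => a; apply: leq_trans (dr' a) _; lia.
Qed.

End Graded.

(** * Minimal resolutions *)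

Section Minimal.
Local Open Scope ring_scope.
Variables (k : fieldType) (n : nat).
Local Notation S := {mpoly k[n]}.

(** Minimality of a set of generators, phrased through their relations so that it concerns one
    matrix and not the next one. *)
Definition minimal_rows p q (A : 'M[S]_(p, q)) :=
  forall c : 'rV_p, c *m A = 0 -> forall a, (c 0 a)@_0%MM = 0.

(** A relation whose entry at [a] has constant term [l <> 0] has a component of degree [d a] with
    entry exactly [l] there, so row [a] can be discarded. *)
Lemma minimal_cover p q d e (A : 'M[S]_(p, q)) M : gmx d e A -> spans A M ->
  exists p' (d' : 'I_p' -> nat) (A' : 'M_(p', q)),
    [/\ gmx d' e A', spans A' M & minimal_rows A'].
Proof.
elim: p d A => [|p IH] d A gA sA.
  by exists 0%N, d, A; split=> // c _ [].
have [mA|] := excluded_middle_informative (minimal_rows A).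
  by exists p.+1, d, A; split.
move=> nmA; have [c [cA [a ca]]] : exists c : 'rV_p.+1, c *m A = 0 /\ exists a, (c 0 a)@_0%MM <> 0.
  apply: NNPP => H; apply: nmA => c cA a; apply: NNPP => ca; apply: H.
  by exists c; split=> //; exists a.
set l := (c 0 a)@_0%MM in ca.
pose c' := vcomp d (d a) c.
have c'A : c' *m A = 0 by rewrite -(vcompM _ _ gA) cA vcomp0.
have c'a : c' 0 a = l%:MP.
  apply/mpolyP => x; rewrite mxE hcompE mcoeffC -[X in _ == X]add0n eqn_add2r mdeg_eq0.
  by case: eqP => [->|_]; rewrite ?mulr1 ?mulr0.
apply: (IH (fun b => d (lift a b)) (row' a A)) => [b j|u].
  by rewrite mxE; apply: gA.
split=> [/sA[w ->]|[w ->]]; last first.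
  apply: gsub_rows (spans_gsub gA sA) _ => b.
  have -> : row b (row' a A) = row (lift a b) A by apply/rowP => j; rewrite !mxE.
  exact: spans_row.
pose w' := w - (w 0 a * (l^-1)%:MP) *: c'.
have w'a : w' 0 a = 0.
  have E (x : S) (u1 u2 : 'rV[S]_p.+1) : (u1 - x *: u2) 0 a = u1 0 a - x * u2 0 a.
    by rewrite !mxE.
  by rewrite E c'a -mulrA -mpolyCM mulVf ?mulr1 ?subrr //; apply/eqP.
exists (col' a w').
have -> : w *m A = w' *m A by rewrite mulmxBl -scalemxAl c'A scaler0 subr0.
apply/rowP => j; rewrite !mxE (bigD1_ord a) //= w'a mul0r add0r.
by apply: eq_bigr => b _; rewrite !mxE.
Qed.

(** Comparison with a cover [A'] of degrees at most [r]: row [a] of [1 - T T'] is a relation of [A].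
    If [d a > r], column [a] of [T'] vanishes for degree reasons and the relation has entry 1 at
    [a]. *)
Lemma minimal_degrees p q d e (A : 'M[S]_(p, q)) M r a :
  gmx d e A -> spans A M -> minimal_rows A -> regular 1 e M r -> (d a <= r)%N.
Proof.
move=> gA sA mA [p' [d' [A' [gA' dr' sA' _]]]].
have [T [gT _ TA]] : exists T : 'M_(p, p'), [/\ gmx d d' T, forall a : 'I_p, True & T *m A' = A].
  apply: (@graded_lift _ _ _ _ _ d d' e (fun=> True)) => // b.
  by have /sA'[c cE] : M (row b A) by [apply: spans_row]; exists c; rewrite -cE.
have [T' [gT' _ TA']] : exists T : 'M_(p', p), [/\ gmx d' d T, forall a : 'I_p', True & T *m A = A'].
  apply: (@graded_lift _ _ _ _ _ d' d e (fun=> True)) => // b.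
  by have /sA[c cE] : M (row b A') by [apply: spans_row]; exists c; rewrite -cE.
rewrite leqNgt; apply/negP => rd.
have := mA (row a (1%:M - T *m T')).
rewrite row_mulE mulmxBl mul1mx -mulmxA TA' TA subrr row0 => /(_ erefl a).
rewrite !mxE eqxx big1 ?subr0 ?mcoeff1 ?eqxx => [/eqP|b _]; first by rewrite oner_eq0.
suff -> : T' b a = 0 by rewrite mulr0.
apply/mpolyP => x; rewrite mcoeff0; apply/eqP; apply: contraTT rd => /gT' h.
by rewrite -leqNgt (leq_trans _ (dr' b)) // -h leq_addl.
Qed.

Lemma minimal_syzygy p q d e (A : 'M[S]_(p, q)) M r :
    gmx d e A -> spans A M -> minimal_rows A -> (forall N, regular N e M r) ->
  (forall a, d a <= r)%N /\ forall N, regular N d (fun c => c *m A = 0) r.+1.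
Proof.
move=> gA sA mA rM; have dr a : (d a <= r)%N by apply: minimal_degrees (rM 1%N).
by split=> // N; apply: regular_syzygy (rM N.+1).
Qed.

Definition dg (s : seq nat) (a : 'I_(size s)) := nth 0%N s a.

Lemma graded_mxP s t (A : 'M[S]_(size s, size t)) :
  graded_mx A <-> gmx (@dg s) (@dg t) A.
Proof.
split=> gA a b; have := gA a b; rewrite /dg.
  case: ifP => [le /dhomogP h x|_ /eqP -> //]; last exact: hom0.
  by rewrite -mcoeff_msupp => /h /= ->; rewrite subnK.
move=> h; case: leqP => [le|lt].
  by apply/dhomogP => x; rewrite mcoeff_msupp => /h <-; rewrite addnK.
apply/eqP/mpolyP => x; rewrite mcoeff0; apply/eqP; apply: contraTT lt => /h <-.
by rewrite -leqNgt leq_addl.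
Qed.

Lemma minimal_cover_seq (t : seq nat) M r : regular 1 (@dg t) M r ->
  exists s (A : 'M[S]_(size s, size t)),
    [/\ gmx (@dg s) (@dg t) A, spans A M & minimal_rows A].
Proof.
case=> [p [d [A [gA _ sA _]]]].
have [{gA sA A d}p' [d' [A' [gA sA mA]]]] := minimal_cover gA sA.
have [s [sp sd]] : exists s, size s = p' /\ forall a : 'I_p', nth 0%N s a = d' a.
  exists [seq d' a | a <- enum 'I_p']; rewrite size_map size_enum_ord; split=> // a.
  by rewrite (nth_map a) ?size_enum_ord // nth_ord_enum.
subst p'; exists s, A'; split=> // a b; rewrite /dg sd; exact: gA.
Qed.

Section Resolution.
Variables (I : S -> Prop) (r : nat).
Hypothesis regI : forall N, regular N (@dg [:: 0%N]) (fun u => I (u 0 0)) r.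

(** The type of each differential depends on the twists found before, so twists and syzygy module
    travel together in a dependent pair. *)
Definition state := {s : seq nat & 'rV[S]_(size s) -> Prop}.

Definition is_step (x : state) (y : {s : seq nat & 'M[S]_(size s, size (projT1 x))}) :=
  [/\ gmx (@dg (projT1 y)) (@dg (projT1 x)) (projT2 y), spans (projT2 y) (projT2 x)
    & minimal_rows (projT2 y)].

Definition step (x : state) : {s : seq nat & 'M[S]_(size s, size (projT1 x))} :=
  epsilon (inhabits (existT (fun s => 'M[S]_(size s, size (projT1 x))) [::] 0))
    (@is_step x).

Definition next (x : state) : state :=
  existT _ (projT1 (step x)) (fun c => c *m projT2 (step x) = 0).

Definition stage i : state :=
  iter i next (existT (fun s => 'rV[S]_(size s) -> Prop) [:: 0%N] (fun u => I (u 0 0))).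

Lemma stepP x s : (forall N, regular N (@dg (projT1 x)) (projT2 x) s) -> is_step (step x).
Proof.
move=> rx; apply: (epsilon_spec _ (@is_step x)).
by have [t [A tA]] := minimal_cover_seq (rx 1%N); exists (existT _ t A).
Qed.

Lemma stage_regular i N : regular N (@dg (projT1 (stage i))) (projT2 (stage i)) (r + i).
Proof.
elim: i N => [|i IH] N; first by rewrite addn0; apply: regI.
have [gA sA mA] := stepP IH.
by rewrite addnS /=; apply: (minimal_syzygy gA sA mA IH).2.
Qed.

Lemma stage_step i : is_step (step (stage i)).
Proof. exact: stepP (stage_regular i). Qed.

Definition stage_resolution : resolution k n :=
  @Resolution k n (fun i => projT1 (stage i.+1)) (projT2 (step (stage 0)))
    (fun i => projT2 (step (stage i.+1))).

Lemma stage_resolutionP :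
  is_graded_resolution I stage_resolution /\ is_minimal stage_resolution.
Proof.
split; first split.
- split=> [|i]; apply/graded_mxP; first by case: (stage_step 0).
  by case: (stage_step i.+1).
- move=> f; have [_ sA _] := stage_step 0.
  by have := sA (f%:M); rewrite /= mxE eqxx mulr1n.
- by move=> v; have [_ sA _] := stage_step 1; apply: sA.
- by move=> i v; have [_ sA _] := stage_step i.+2; apply: sA.
(* Rows of one matrix are relations of the preceding one, hence have no constant terms. *)
- move=> i a b.
  have [_ sA _] := stage_step i.+1; have [_ _ mA] := stage_step i.
  by have := mA _ (spans_row a sA) b; rewrite mxE.
Qed.

(** The choice made by [epsilon] has its defining property once some minimal resolution exists. *)
Lemma minimal_resolutionP :
  is_graded_resolution I (minimal_resolution I) /\ is_minimal (minimal_resolution I).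
Proof.
exact: (epsilon_spec _ (fun F => is_graded_resolution I F /\ is_minimal F)
  (ex_intro _ _ stage_resolutionP)).
Qed.

End Resolution.

Lemma resolution_degrees (I : S -> Prop) r (F : resolution k n) :
    (forall N, regular N (@dg [:: 0%N]) (fun u => I (u 0 0)) r) ->
    is_graded_resolution I F -> is_minimal F ->
  forall i a, (dg (s := degs F i) a <= r + i)%N.
Proof.
move=> rI [[gA gD] sA s0 sD] mF.
(* By exactness each relation of [B] is a combination of rows of [A], so minimality of the
   resolution becomes minimality of generators. *)
have rows_min p q s (A : 'M[S]_(p, q)) (B : 'M[S]_(q, s)) :
    spans A (fun v => v *m B = 0) -> (forall a b, (A a b)@_0%MM = 0) -> minimal_rows B.
  move=> sAB A0 c /sAB[w ->] b; rewrite mxE raddf_sum big1 // => a _.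
  by rewrite /= rmorphM /= A0 mulr0.
have mA : minimal_rows (aug F) by apply: rows_min (mF 0%N) => v; apply: s0.
have mD i : minimal_rows (diff F i) by apply: rows_min (mF i.+1) => v; apply: sD.
have sI : spans (aug F) (fun u => I (u 0 0)).
  by move=> u; rewrite sA (_ : (u 0 0)%:M = u) // -mx11_scalar.
have h0 := minimal_syzygy ((graded_mxP (t := [:: 0%N]) _).1 gA) sI mA rI.
pose K i : 'rV[S]_(size (degs F i)) -> Prop :=
  match i with 0%N => fun c => c *m aug F = 0 | j.+1 => fun c => c *m diff F j = 0 end.
have sK i : spans (diff F i) (K i) by case: i => [|i] v; [apply: s0 | apply: sD].
have h i : (forall a, dg (s := degs F i) a <= r + i)%N /\
    forall N, regular N (@dg (degs F i)) (K i) (r + i).+1.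
  elim: i => [|i [_ IH]]; first by rewrite addn0.
  rewrite addnS; exact: (minimal_syzygy ((graded_mxP _).1 (gD i)) (sK i) (mD i) IH).
by move=> i a; apply: (h i).1.
Qed.

End Minimal.

(** * Nonedge ideals *)

Section MonomialIdeals.
Local Open Scope ring_scope.
Variables (k : fieldType) (n : nat).
Local Notation S := {mpoly k[n]}.
Local Notation mon := 'X_{1..n}.
Local Notation e0 := (@dg [:: 0%N]).

(** Monomial ideals are given by their sets of exponents; [upward] is the ideal property. *)
Definition supported (Q : mon -> Prop) (f : S) := forall m, f@_m != 0 -> Q m.

Definition upward (Q : mon -> Prop) := forall m m', Q m -> Q (m + m')%MM.

Lemma supported0 Q : supported Q 0.
Proof. by move=> m; rewrite mcoeff0 eqxx. Qed.

Lemma supportedD Q f g : supported Q f -> supported Q g -> supported Q (f + g).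
Proof.
move=> Qf Qg m; rewrite mcoeffD; have [->|fm _] := eqVneq f@_m 0; last exact: Qf.
by rewrite add0r; apply: Qg.
Qed.

Lemma supportedM Q f g : upward Q -> supported Q f -> supported Q (f * g).
Proof.
move=> upQ Qf m; rewrite mcoeffM => fg.
have [[y z] /= /eqP mE yz] : exists2 j : 'X_{1..n < (mdeg m).+1, (mdeg m).+1},
    m == (j.1 + j.2)%MM & f@_j.1 * g@_j.2 != 0.
  apply: NNPP => H; move/eqP: fg; apply; apply: big1 => j mj.
  by apply/eqP; apply/negPn/negP => h; apply: H; exists j.
by rewrite mE; apply: upQ; apply: Qf; apply: contraNneq yz => ->; rewrite mul0r.
Qed.

Lemma supported_sum (I : Type) (r : seq I) (P : pred I) Q (F : I -> S) :
  (forall i, P i -> supported Q (F i)) -> supported Q (\sum_(i <- r | P i) F i).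
Proof. by move=> h; apply: big_ind => //; [apply: supported0 | move=> *; apply: supportedD]. Qed.

Lemma supportedX Q m c : Q m -> supported Q (c *: 'X_[m]).
Proof.
move=> Qm m'; rewrite mcoeffZ mcoeffX; have [<-//|_] := eqVneq m m'.
by rewrite mulr0 eqxx.
Qed.

Definition mideal Q (u : 'rV[S]_1) := supported Q (u 0 0).

Lemma gsub_mideal Q : upward Q -> gsub e0 (mideal Q).
Proof.
move=> upQ; split=> [|u w Qu Qw|c u Qu|m u Qu]; rewrite /mideal.
- by rewrite mxE; apply: supported0.
- by rewrite mxE; apply: supportedD.
- by rewrite mxE mulrC; apply: supportedM.
- by move=> x; rewrite mxE hcompE; case: ifP => _; [apply: Qu | rewrite eqxx].
Qed.

Lemma gsub_image q s (e : 'I_q -> nat) (h : 'I_s -> nat) (F : 'M[S]_(q, s)) M :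
  gmx e h F -> gsub e M -> gsub h (fun w => exists2 u, M u & w = u *m F).
Proof.
move=> gF gM; split.
- by exists 0; rewrite ?mul0mx //; apply: gsub0 gM.
- by move=> _ _ [u Mu ->] [w Mw ->]; exists (u + w); rewrite ?mulmxDl //; apply: gsubD gM _ _ Mu Mw.
- by move=> c _ [u Mu ->]; exists (c *: u); rewrite ?scalemxAl //; apply: gsubZ gM _ _ Mu.
- by move=> m _ [u Mu ->]; exists (vcomp e m u); rewrite ?(vcompM _ _ gF) //; apply: gsubH gM _ _ Mu.
Qed.

Lemma gsub_and q (e : 'I_q -> nat) (M M' : 'rV[S]_q -> Prop) :
  gsub e M -> gsub e M' -> gsub e (fun w => M w /\ M' w).
Proof.
move=> gM gM'; split.
- by split; [apply: gsub0 gM | apply: gsub0 gM'].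
- by move=> u w [? ?] [? ?]; split; [apply: gsubD gM _ _ _ _ | apply: gsubD gM' _ _ _ _].
- by move=> c u [? ?]; split; [apply: gsubZ gM _ _ _ | apply: gsubZ gM' _ _ _].
- by move=> m u [? ?]; split; [apply: gsubH gM _ _ _ | apply: gsubH gM' _ _ _].
Qed.

Lemma supported_split QI QL v f :
    supported (fun m => QI m \/ (0 < m v)%N /\ QL (m - U_(v))%MM) f ->
  exists f1 l, [/\ supported QI f1, supported QL l & f = f1 + l * 'X_v].
Proof.
move=> Qf; pose p m : bool := if excluded_middle_informative (QI m) then true else false.
have pP m : reflect (QI m) (p m) by rewrite /p; case: excluded_middle_informative => h; constructor.
exists (\sum_(m <- msupp f | p m) f@_m *: 'X_[m]).
exists (\sum_(m <- msupp f | ~~ p m && (m \in msupp f)) f@_m *: 'X_[m - U_(v)]); split.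
- by apply: supported_sum => m /pP Qm; apply: supportedX.
- apply: supported_sum => m /andP[/pP nQm]; rewrite mcoeff_msupp => /Qf [//|[_ Lm]].
  exact: supportedX.
- rewrite {1}[f]mpolyE (bigID p) /=; congr (_ + _); rewrite mulr_suml.
  rewrite big_seq_cond; rewrite [in RHS]big_seq_cond; apply: eq_big => m.
    by rewrite andbC [in RHS]andbC -andbA andbb.
  case/andP; rewrite mcoeff_msupp => /Qf [/pP -> //|[mv _] _].
  rewrite -scalerAl -mpolyXD submK //; apply/mnm_lepP => i; rewrite mnm1E.
  by case: eqP => [<-|].
Qed.

(** The ideal [I + x_v L] is the quotient of [I] plus [x_v L] (direct sum) by their intersection,
    which is [x_v I] because [x_v] is a nonzerodivisor modulo [I]. Multiplication by [x_v] shifts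
    degrees, so [x_v L] has bound [r.+1] and [x_v I] has bound [r.+2], just what [regular_quotient]
    asks. *)
Lemma regular_mono_step N QI QL v r :
    upward QI -> upward QL -> (forall m, QI m -> QL m) ->
    (forall m, QI (m + U_(v))%MM -> QI m) ->
    regular N e0 (mideal QI) r.+1 -> regular N e0 (mideal QL) r ->
  regular N e0 (mideal (fun m => QI m \/ (0 < m v)%N /\ QL (m - U_(v))%MM)) r.+1.
Proof.
move=> upI upL IL nzd rI rL.
pose X : 'M[S]_1 := ('X_v)%:M.
pose e1 := fun j => (e0 j).+1.
have gX : gmx e1 e0 X.
  move=> a b; rewrite mxE !ord1 eqxx; apply: homX.
have mulX (u : 'rV[S]_1) : (u *m X) 0 0 = u 0 0 * 'X_v.
  by rewrite mul_mx_scalar mxE mulrC.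
have injX (u : 'rV[S]_1) : u *m X = 0 -> u = 0.
  move=> /rowP/(_ 0); rewrite mulX mxE => /eqP; rewrite mulf_eq0 => /orP[/eqP u0|/eqP].
    by apply/rowP => j; rewrite ord1 mxE.
  by move/(congr1 (mcoeff U_(v)%MM)); rewrite mcoeffX eqxx mcoeff0 => /eqP; rewrite oner_eq0.
pose XL := fun w => exists2 u, mideal QL u & w = u *m X.
have gXL : gsub e0 XL.
  apply: (gsub_image gX); split=> [|u w|c u|m u].
  - exact: gsub0 (gsub_mideal upL).
  - exact: gsubD (gsub_mideal upL) u w.
  - exact: gsubZ (gsub_mideal upL) c u.
  (* After the twist, degree [m] is the former degree [m.-1], and degree 0 is empty. *)
  - move=> Lu; have -> : vcomp e1 m u = vcomp e0 m.-1 u *+ (0 < m).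
      apply/rowP => j; apply/mpolyP => x.
      case: m => [|m]; rewrite ?mulr0n ?mulr1n !mxE !hcompE ?mcoeff0 /e1 addnS //.
    by case: m => [|m]; [apply: gsub0 (gsub_mideal upL)|apply: gsubH (gsub_mideal upL) _ _ Lu].
have rXL : regular N e0 XL r.+1.
  apply: (regular_image gX) => [u _|]; [exact: injX | exact: (regular_shift rL)].
pose B w := mideal QI (w *m col_mx 1%:M 0) /\ XL (w *m col_mx 0 1%:M).
have BE a b : B (row_mx a b) <-> mideal QI a /\ XL b.
  by rewrite /B !mul_row_col !mulmx1 !mulmx0 addr0 add0r.
have gB : gsub (jd e0 e0) B.
  apply: gsub_and; [apply: gsub_mul (gsub_mideal upI)|apply: gsub_mul gXL].
    by apply: gmx_col; [apply: gmx1|apply: gmx0].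
  by apply: gmx_col; [apply: gmx0|apply: gmx1].
have rB : regular N (jd e0 e0) B r.+1.
  apply: (@regular_extension _ _ N 1 (1 + 1) 1 e0 (jd e0 e0) e0 (mideal QI) B XL
     (row_mx 1%:M 0) (col_mx 0 1%:M)) => //.
  - by apply: gmx_row; [apply: gmx1|apply: gmx0].
  - by apply: gmx_col; [apply: gmx0|apply: gmx1].
  - move=> u Iu; rewrite mul_mx_row mulmx1 mulmx0; apply/BE; split=> //.
    exact: gsub0 gXL.
  - by move=> w [].
  - move=> z XLz; exists (row_mx 0 z); rewrite mul_row_col mulmx0 mulmx1 add0r; split=> //.
    by apply/BE; split=> //; apply: gsub0 (gsub_mideal upI).
  - by move=> u _; rewrite mul_mx_row mul_row_col !mulmx0 mul0mx addr0.
  - move=> w; rewrite -[w]hsubmxK => /BE[Iw _]; rewrite mul_row_col mulmx0 mulmx1 add0r => ->.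
    by exists (lsubmx w); rewrite mul_mx_row mulmx1 mulmx0.
  - by move=> u _; rewrite mul_mx_row mulmx1 => /(congr1 lsubmx); rewrite row_mxKl linear0.
apply: (@regular_quotient _ _ N (1 + 1) 1 (jd e0 e0) e0 (col_mx 1%:M 1%:M) B) => //.
- by apply: gmx_col; apply: gmx1.
- move=> z; split=> [/supported_split[f1 [l [If Ll zE]]]|[w]].
    exists (row_mx f1%:M (l%:M *m X)).
      apply/BE; split; first by rewrite /mideal mxE eqxx.
      by exists l%:M; rewrite // /mideal mxE eqxx.
    rewrite mul_row_col !mulmx1; apply/rowP => j; rewrite ord1 zE [RHS]mxE mulX.
    by rewrite !mxE !eqxx.
  rewrite -[w]hsubmxK => /BE[Iw [u Lu uE]] ->.
  rewrite mul_row_col !mulmx1 uE /mideal [X in supported _ X]mxE mulX.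
  apply: supportedD => m; first by move/Iw; left.
  have [mv|mv] := posnP (m v); last first.
    have mE : (m - U_(v) + U_(v))%MM = m.
      by apply: submK; apply/mnm_lepP => i; rewrite mnm1E; case: eqP => [<-|].
    by rewrite -{1}mE addmC mcoeffMX => /Lu; right.
  rewrite mcoeffMr big1 ?eqxx // => -[y z'] /= /eqP mE.
  rewrite mcoeffX; case: eqP => [vz|]; last by rewrite mulr0.
  by have := congr1 (fun q : mon => q v) mE; rewrite /= mv mnmDE -vz mnm1E eqxx; lia.
- apply: (@regular_ext _ _ _ _ _ (fun w => exists2 u, mideal QI u & w = u *m row_mx X (- X))).
    move=> w; split=> [[u Iu ->]|].
      rewrite mul_mx_row mul_row_col !mulmx1 mulmxN subrr; split=> //; apply/BE; split.
        by rewrite /mideal mulX; apply: supportedM.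
      exists (- u); rewrite ?mulNmx // /mideal => m; rewrite mxE mcoeffN oppr_eq0.
      by move/Iu; apply: IL.
    rewrite -[w]hsubmxK => -[/BE[Iw [u Lu uE]]]; rewrite mul_row_col !mulmx1 uE.
    move/eqP; rewrite addr_eq0 => /eqP wE; exists (- u); last first.
      by rewrite mul_mx_row wE mulmxN !mulNmx opprK.
    move=> m um; apply: nzd; apply: Iw; rewrite wE -mulNmx mulX addmC mcoeffMX //.
  apply: (@regular_image _ _ _ _ _ e1) (regular_shift rI).
    by apply: gmx_row => //; apply: gmx_opp.
  by move=> u _; rewrite mul_mx_row => /(congr1 lsubmx); rewrite row_mxKl linear0; apply: injX.
Qed.

Variable G : graph 'I_n.

(** The monomials of the nonedge ideal of [G[W]] enlarged by the variables of [U], the shape of the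
    second ideal in the deletion formula. *)
Definition nonedge_mon (W U : {set 'I_n}) (m : mon) :=
  (exists i j, [/\ i \in W, j \in W, i != j, ~~ G i j & (0 < m i) && (0 < m j)]%N) \/
  exists2 u, u \in U & (0 < m u)%N.

Lemma upward_nonedge W U : upward (nonedge_mon W U).
Proof.
move=> m m' [[i [j [iW jW ij Gij /andP[mi mj]]]]|[u uU mu]].
  by left; exists i, j; split=> //; rewrite !mnmDE !addn_gt0 mi mj.
by right; exists u; rewrite // mnmDE addn_gt0 mu.
Qed.

Definition nonedge_regular W U r := forall N, regular N e0 (mideal (nonedge_mon W U)) r.

Lemma nonedge_mon_addU v (W U : {set 'I_n}) m : v \notin W -> v \notin U ->
  nonedge_mon W U (m + U_(v))%MM -> nonedge_mon W U m.
Proof.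
move=> vW vU; have E i : i != v -> (m + U_(v))%MM i = m i.
  by move=> iv; rewrite mnmDE mnm1E eq_sym (negbTE iv) addn0.
case=> [[i [j [iW jW ij Gij h]]]|[u uU mu]].
  left; exists i, j; split=> //; move: h; rewrite !E //; first by apply: contraNneq vW => <-.
  by apply: contraNneq vW => <-.
by right; exists u => //; move: mu; rewrite E //; apply: contraNneq vU => <-.
Qed.

Lemma mideal_ext Q Q' u : (forall m, Q m <-> Q' m) -> mideal Q u <-> mideal Q' u.
Proof. by move=> QQ; split=> h m /h /QQ. Qed.

(** [regular_mono_step] with the whole ring as [L], which is generated in degree 0. *)
Lemma nonedge_regular_var (W U : {set 'I_n}) u r : u \notin W ->
  nonedge_regular W U r.+1 -> nonedge_regular W (u |: U) r.+1.
Proof.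
move=> uW rW N; have [uU|uU] := boolP (u \in U).
  have -> : u |: U = U by apply/setUidPr; rewrite sub1set.
  exact: rW.
have rT : regular N e0 (mideal (fun=> True)) r.
  by apply: regular_ext (@regular_full _ _ N 1 e0 r _) => // j; rewrite /dg ord1.
apply: regular_ext (@regular_mono_step N _ _ u r _ _ _ _ (rW N) rT) => //.
- move=> w; apply: mideal_ext => m; split.
    case=> [[?|[x xU mx]]|[mu _]]; [by left | | by right; exists u; rewrite // setU11].
    by right; exists x; rewrite // in_setU1 xU orbT.
  case=> [?|[x]]; first by left; left.
  by rewrite in_setU1 => /orP[/eqP ->|xU] mx; [right | left; right; exists x].
- exact: upward_nonedge.
- by move=> m; apply: nonedge_mon_addU.
Qed.

Lemma nonedge_regular_vars (W U : {set 'I_n}) r : [disjoint W & U] ->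
  nonedge_regular W set0 r.+1 -> nonedge_regular W U r.+1.
Proof.
move=> WU rW; elim: {U}_.+1 {-2}U (ltnSn #|U|) WU => // c IH U leU WU.
have [->//|[u uU]] := set_0Vmem U.
rewrite -(setD1K uU); apply: nonedge_regular_var.
  by apply: contraL uU => uW; rewrite (disjointFr WU uW).
apply: IH; first by rewrite (cardsD1 u U) uU in leU.
by apply: disjointWr WU; apply: subD1set.
Qed.

Lemma nonedge_regular_vertex v (W : {set 'I_n}) r : v \in W ->
    nonedge_regular (W :\ v) set0 r.+2 ->
    nonedge_regular [set u in W | G v u] set0 r.+1 ->
  nonedge_regular W set0 r.+2.
Proof.
move=> vW r1 r2 N.
pose A := [set u in W | G v u]; pose U := [set u in W | (u != v) && ~~ G v u].
have rL : nonedge_regular A U r.+1.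
  apply: nonedge_regular_vars => //; rewrite -setI_eq0; apply/eqP/setP => u.
  by rewrite !inE; case: (G v u); rewrite ?andbF.
have vA : v \notin A by rewrite inE adj_irr andbF.
have vU : v \notin U by rewrite inE eqxx andbF.
have L1 m : nonedge_mon (W :\ v) set0 (m + U_(v))%MM -> nonedge_mon (W :\ v) set0 m.
  by apply: nonedge_mon_addU; rewrite ?inE ?eqxx.
have L2 m : nonedge_mon (W :\ v) set0 m -> nonedge_mon A U m.
  move=> [[i [j [iW jW ij Gij /andP[mi mj]]]]|[u]]; last by rewrite inE.
  move: iW jW; rewrite !in_setD1 => /andP[iv iW] /andP[jv jW].
  have [iG|iG] := boolP (G v i); last by right; exists i; rewrite // inE iW iv.
  have [jG|jG] := boolP (G v j); last by right; exists j; rewrite // inE jW jv.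
  by left; exists i, j; split=> //; rewrite ?inE ?iW ?jW ?mi.
apply: regular_ext (regular_mono_step (@upward_nonedge _ _) (@upward_nonedge _ _) L2 L1 (r1 N) (rL N)).
move=> w; apply: mideal_ext => m; split.
  case=> [[[i [j [iW jW ij Gij h]]]|[u]]|[mv L]]; last 2 first.
  - by rewrite inE.
  - have mE : (m - U_(v) + U_(v))%MM = m.
      by apply: submK; apply/mnm_lepP => i; rewrite mnm1E; case: eqP => [<-|].
    have {L} : nonedge_mon A U m.
      by rewrite -mE; apply: upward_nonedge.
    case=> [[i [j [iA jA ij Gij h]]]|[u uU mu]].
      left; exists i, j; split=> //; [by case/setIdP: iA | by case/setIdP: jA].
    case/setIdP: uU => uW /andP[uv nG]; left; exists v, u; split; rewrite ?mv //.
    by rewrite eq_sym.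
  - by left; exists i, j; split=> //; [case/setD1P: iW | case/setD1P: jW].
case=> [[i [j [iW jW ij Gij /andP[mi mj]]]]|[u]]; last by rewrite inE.
have key x : x \in W -> x != v -> ~~ G v x -> (0 < m x)%N -> (0 < m v)%N ->
    (0 < m v)%N /\ nonedge_mon A U (m - U_(v))%MM.
  move=> xW xv nG mx mv; split=> //; right; exists x; first by rewrite inE xW xv.
  by rewrite mnmBE mnm1E eq_sym (negbTE xv) subn0.
have [iv|iv] := eqVneq i v; first by right; apply: (key j); rewrite -?iv // eq_sym.
have [jv|jv] := eqVneq j v; first by right; apply: (key i); rewrite -?jv // adj_sym.
by left; left; exists i, j; split=> //; rewrite ?in_setD1 ?iv ?jv ?mi.
Qed.

Lemma nonedge_regular_clique (W : {set 'I_n}) r :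
  (forall x y, x \in W -> y \in W -> x != y -> G x y) -> nonedge_regular W set0 r.
Proof.
move=> clW N; apply: regular_zero => u; split=> [Qu|-> m]; last by rewrite mxE mcoeff0 eqxx.
apply/rowP => j; rewrite ord1 mxE; apply/mpolyP => m; rewrite mcoeff0; apply/eqP/negPn/negP.
move/Qu => [[a [b [aW bW ab nG _]]]|[x]]; last by rewrite inE.
by move: nG; rewrite clW.
Qed.

Lemma nonedge_idealP f : nonedge_ideal G f <-> supported (nonedge_mon [set: 'I_n] set0) f.
Proof.
split=> [[c ->]|Qf].
  apply: supported_sum => i _; apply: supported_sum => j /andP[ij Gij].
  rewrite mulrC; apply: supportedM; first exact: upward_nonedge.
  rewrite -mpolyXD -[X in supported _ X]scale1r; apply: supportedX.
  left; exists i, j; split; rewrite ?inE // !mnmDE !mnm1E !eqxx addn1 addn_gt0.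
  by rewrite andbT -?addnS ltnS ?leq0n ?orbT.
have I0 : nonedge_ideal G (0 : S).
  exists (fun _ _ => 0); rewrite big1 // => i _; rewrite big1 // => j _; exact: mul0r.
have ID (f1 f2 : S) : nonedge_ideal G f1 -> nonedge_ideal G f2 -> nonedge_ideal G (f1 + f2).
  move=> [c ->] [c' ->]; exists (fun i j => c i j + c' i j).
  rewrite -big_split; apply: eq_bigr => i _; rewrite -big_split; apply: eq_bigr => j _.
  by rewrite mulrDl.
rewrite [f]mpolyE big_seq; apply: big_ind => // m; rewrite mcoeff_msupp => /Qf.
case=> [[i [j [_ _ ij Gij /andP[mi mj]]]]|[u]]; last by rewrite inE.
exists (fun i' j' => if (i' == i) && (j' == j) then f@_m *: 'X_[m - U_(i) - U_(j)] else 0).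
rewrite (bigD1 i) //= (bigD1 j) /=; last by rewrite ij.
rewrite !eqxx /= big1 => [|j' /andP[_ /negbTE ->]]; last exact: mul0r.
rewrite addr0 big1 => [|i' /negbTE ->]; last by rewrite big1 // => j' _; exact: mul0r.
rewrite addr0 -scalerAl -!mpolyXD; congr (_ *: 'X_[_]); apply/mnmP => x.
rewrite !mnmDE !mnmBE !mnm1E; have [ix|_] := eqVneq i x.
  by rewrite -ix eq_sym (negbTE ij); lia.
by case: eqVneq => [jx|_]; rewrite -?jx; lia.
Qed.

End MonomialIdeals.

(** * From truncated resolutions to [reg] *)

Section RegularityBound.
Local Open Scope ring_scope.

(** The maximum in [reg] is chosen by [epsilon], so its existence has to be shown: a nonedge gives a
    generator, and [r] bounds all degrees. Positivity of [r] covers the convention for complete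
    graphs. *)
Lemma reg_le (k : fieldType) n (G : graph 'I_n) r : (0 < r)%N ->
  nonedge_regular k G [set: 'I_n] set0 r -> (reg k G <= r)%N.
Proof.
move=> r0 rG; rewrite /reg; case: ifP => // nc.
set I := @nonedge_ideal k n G.
have regI N : regular N (@dg [:: 0%N]) (fun u => I (u 0 0)) r.
  by apply: regular_ext (rG N) => u; rewrite /I nonedge_idealP.
have [gF mF] := minimal_resolutionP regI.
have dF := resolution_degrees regI gF mF.
pose P d := exists i, betti I i (i + d) <> 0%N.
have Pr d : P d -> (d <= r)%N.
  case=> i /eqP; rewrite -lt0n -has_count has_pred1 => /(nthP 0%N)[a a1 aE].
  by have := dF i (Ordinal a1); rewrite /dg aE; lia.
have [d0 Pd0] : exists d, P d.
  have [x [y [xy nG]]] : exists x y, x != y /\ ~~ G x y.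
    move/negbT: nc; rewrite /complete negb_forall => /existsP[x].
    rewrite negb_forall => /existsP[y]; rewrite negb_imply => /andP[xy nG].
    by exists x, y.
  have [_ sA _ _] := gF.
  have : I ('X_x * 'X_y).
    apply/nonedge_idealP; rewrite -mpolyXD -[X in supported _ X]scale1r; apply: supportedX.
    left; exists x, y; split; rewrite ?inE // !mnmDE !mnm1E !eqxx; lia.
  (* Without generators in step 0 the product of the two variables would be zero. *)
  move=> /sA[v vE]; case E: (degs (minimal_resolution I) 0) => [|d s].
    suff : 'X_x * 'X_y = 0 :> {mpoly k[n]}.
      move/eqP; rewrite mulf_eq0 => /orP[] /eqP/(congr1 (mcoeff _)).
        by move/(_ U_(x)%MM)/eqP; rewrite mcoeffX eqxx mcoeff0 oner_eq0.
      by move/(_ U_(y)%MM)/eqP; rewrite mcoeffX eqxx mcoeff0 oner_eq0.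
    have := congr1 (fun A : 'M_1 => A 0 0) vE; rewrite !mxE eqxx mulr1n => ->.
    by rewrite big1 // => -[a a1] _; exfalso; rewrite E in a1.
  exists d, 0%N; rewrite /betti E /= eqxx; lia.
have exm : exists m, is_max P m.
  have [m Hm1 Hm2] : exists2 m, P m & forall d, P d -> (d <= m)%N.
    apply: NNPP => H.
    suff H' d : (d <= r.+1)%N -> exists2 m, P m & (d <= m)%N.
      by have [m /Pr mr] := H' _ (leqnn _); rewrite leqNgt ltnS mr.
    elim: d => [|d IHd] dr; first by exists d0.
    have [m Pm dm] := IHd (ltnW dr).
    apply: NNPP => H2; apply: H; exists m => // d' Pd'; rewrite leqNgt; apply/negP => md'.
    by apply: H2; exists d'; rewrite ?(leq_ltn_trans dm).
  by exists m.
exact: Pr (epsilon_spec (inhabits 0%N) _ exm).1.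
Qed.

End RegularityBound.

(** * Deletion of vertices for chordal graphs and for graphs with long even holes *)

Section Regularity.
Variables (k : fieldType) (n : nat) (G : graph 'I_n).

(** The neighbourhood of a simplicial vertex has zero ideal, which satisfies the bound 1 needed to
    keep 2 for the whole graph. *)
Lemma chordal_regular (W0 W : {set 'I_n}) :
    (forall c, hole G c -> ~ {subset c <= W0}) -> W \subset W0 ->
  nonedge_regular k G W set0 2.
Proof.
move=> nohole; elim: {W}_.+1 {-2}W (ltnSn #|W|) => // m IH W leW WW0.
have [->|W0'] := eqVneq W set0.
  by apply: nonedge_regular_clique => x y; rewrite inE.
have noholeW c : hole G c -> ~ {subset c <= W}.
  by move=> hc sub; apply: (nohole c hc) => x /sub; apply: (subsetP WW0).
have [v vW simp] := simplicial_vertex noholeW W0'.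
apply: (nonedge_regular_vertex vW).
  apply: IH; last exact: subset_trans (subD1set _ _) WW0.
  by rewrite (cardsD1 v) vW in leW.
apply: nonedge_regular_clique => x y; rewrite !inE => /andP[xW vx] /andP[yW vy].
exact: simp.
Qed.

(** The neighbourhood of the deleted vertex is chordal and has bound 2, so the bound 3 persists. *)
Lemma hole_free_regular (W : {set 'I_n}) :
    (forall c, hole G c -> size c <> 4 /\ ~~ odd (size c)) ->
  nonedge_regular k G W set0 3.
Proof.
move=> even; elim: {W}_.+1 {-2}W (ltnSn #|W|) => // m IH W leW.
have [->|W0'] := eqVneq W set0.
  by apply: nonedge_regular_clique => x y; rewrite inE.
have [v vW nohole] := hole_free_vertex even W0'.
apply: (nonedge_regular_vertex vW).
  by apply: IH; rewrite (cardsD1 v) vW in leW.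
exact: chordal_regular nohole (subxx _).
Qed.

End Regularity.

Theorem corollary1p5 (k : fieldType) (char_k : [pchar k]%R =i pred0)
    (n : nat) (G : graph 'I_n)
    (perfect_G : perfect G)
    (no_4hole : forall c : seq 'I_n, hole G c -> size c <> 4) :
  reg k G <= 3.
Proof.
apply: reg_le => //; apply: hole_free_regular => c hc.
exact: conj (no_4hole c hc) (perfect_odd_hole perfect_G hc).
Qed.
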